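(* Let $A,B,B_0>0$ and $\alpha>\beta>1$, and let $U$ be the magnetic-repulsive energy defined in the context. (i) For every fixed $N\ge2$ there is a unique $r>0$ such that the ring $\mathfrak{R}_r$ with $N$ particles (defined in the context) is a critical point of $U$ in $(\mathbb{R}^3\times\mathbb{S}^2)^N$. This radius is $r=r_N^*$ given by $$r_N^*=\left(\frac{\widetilde A_N}{\widetilde B_N}\right)^{\frac1{\alpha-\beta}},\quad \widetilde A_N=\frac{\alpha A}{2^{\alpha+1}}\sum_{j=1}^{N-1}\frac1{|\sin(\frac{j\pi}{N})|^{\alpha}},\quad \widetilde B_N=\frac{\beta}{2^{\beta+1}}\sum_{j=1}^{N-1}\frac{(B-B_0)\cos^2(\frac{j\pi}{N})+B_0}{|\sin(\frac{j\pi}{N})|^{\beta}} .$$ (ii) As $N\to\infty$, $r_N^*\sim \frac{N}{2\pi}\bar h$, where $\bar h=\left(\frac{\alpha A\zeta(\alpha)}{\beta B\zeta(\beta)}\right)^{\frac1{\alpha-\beta}}$. Moreover, the distance between two nearest particles of $\mathfrak{R}_{r_N^*}$ converges to $\bar h$: there is a constant $C>0$ independent of $N$ and $k$ such that for all $N\geq 2$ and all $k=0,\dots,N-1$ (with the convention $x_N=x_0$), $$\Big||x_k-x_{k+1}|-\bar h\Big|\le C\cdot\begin{cases}N^{-2}&\text{if }\beta>3,\\ N^{-2}\log N&\text{if }\beta=3,\\ N^{1-\beta}&\text{if }1<\beta<3.\end{cases}$$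
   Context: A configuration of $N$ magnetic particles is $(X,M)=((x_0,m_0),\dots,(x_{N-1},m_{N-1}))\in(\mathbb{R}^3\times\mathbb{S}^2)^N$ with pairwise distinct positions. Put $r_{k\ell}=x_k-x_\ell$. The energy is $$U(X,M)=\sum_{k}\sum_{\ell<k}\left(B_0\frac{m_k\cdot m_\ell}{|r_{k\ell}|^{\beta}}-(B+B_0)\frac{(m_k\cdot r_{k\ell})(m_\ell\cdot r_{k\ell})}{|r_{k\ell}|^{\beta+2}}+\frac{A}{|r_{k\ell}|^{\alpha}}\right).$$ Critical points in $(\mathbb{R}^3\times\mathbb{S}^2)^N$ are critical points of $U$ as a function on the open subset of this manifold where positions are pairwise distinct (each $m_k$ varies on the unit sphere). For $r>0$, the ring $\mathfrak{R}_r$ is the configuration $$x_k=r\left(\cos\tfrac{2\pi k}{N},\sin\tfrac{2\pi k}{N},0\right),\qquad m_k=\left(-\sin\tfrac{2\pi k}{N},\cos\tfrac{2\pi k}{N},0\right),\qquad k=0,\dots,N-1.$$ $\zeta(s)=\sum_{n\ge1}n^{-s}$. *)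

(* Defs.v *)
From HB Require Import structures.
From mathcomp Require Import all_boot all_order all_algebra.
From mathcomp Require Import all_classical all_reals all_analysis.

Set Implicit Arguments.
Unset Strict Implicit.
Unset Printing Implicit Defensive.

Import Order.TTheory GRing.Theory Num.Theory.
Import numFieldNormedType.Exports.

Local Open Scope classical_set_scope.
Local Open Scope ring_scope.

(* The library norm on 'rV[R]_3 is the sup norm; spheres and distances below
   use the Euclidean norm [enorm] instead. *)
Definition dot (R : realType) (u v : 'rV[R]_3) : R := \sum_(i < 3) u 0 i * v 0 i.

Definition enorm (R : realType) (u : 'rV[R]_3) : R := Num.sqrt (dot u u).

Definition vec3 (R : realType) (a b c : R) : 'rV[R]_3 :=
  \row_(i < 3) [:: a; b; c]`_i.

(* A pair (X, M) : row k of X is the position x_k, row k of M the moment m_k. *)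
Definition config (R : realType) (N : nat) : normedModType R :=
  ('M[R]_(N, 3) * 'M[R]_(N, 3))%type.

Definition pos (R : realType) (N : nat) (p : config R N) (k : 'I_N) : 'rV[R]_3 :=
  row k p.1.

Definition moment (R : realType) (N : nat) (p : config R N) (k : 'I_N) : 'rV[R]_3 :=
  row k p.2.

(* The open part of (R^3 x S^2)^N where positions are pairwise distinct, as a
   subset of the ambient space (R^3 x R^3)^N. *)
Definition config_space (R : realType) (N : nat) : set (config R N) :=
  [set p | injective (pos p) /\ forall k, enorm (moment p k) = 1].

Definition energy (R : realType) (A B B0 alpha beta : R) (N : nat)
    (p : config R N) : R :=
  \sum_(k < N) \sum_(l < N | (l < k)%N)
    let r := pos p k - pos p l in
    let mk := moment p k in
    let ml := moment p l in
    B0 * (dot mk ml / enorm r `^ beta)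
    - (B + B0) * (dot mk r * dot ml r / enorm r `^ (beta + 2))
    + A / enorm r `^ alpha.

(* [p] is a critical point of the restriction of [f] to the submanifold [S]:
   the differential of that restriction vanishes on every tangent vector at p,
   tangent vectors being the velocities of curves in [S] through [p]. *)
Definition critical_point_on (R : realType) (V : normedModType R)
    (S : set V) (f : V -> R) (p : V) : Prop :=
  S p /\
  forall c : R -> V,
    c 0 = p -> (\forall t \near (0 : R), S (c t)) -> derivable c 0 1 ->
    is_derive (0 : R) (1 : R) (f \o c) 0.

Definition ring_config (R : realType) (N : nat) (r : R) : config R N :=
  let theta (k : 'I_N) := 2 * pi * k%:R / N%:R in
  (\matrix_(k < N) (r *: vec3 (cos (theta k)) (sin (theta k)) 0),
   \matrix_(k < N) vec3 (- sin (theta k)) (cos (theta k)) 0).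

Definition Atilde (R : realType) (A alpha : R) (N : nat) : R :=
  alpha * A / 2 `^ (alpha + 1) *
  \sum_(1 <= j < N) 1 / `|sin (j%:R * pi / N%:R)| `^ alpha.

Definition Btilde (R : realType) (B B0 beta : R) (N : nat) : R :=
  beta / 2 `^ (beta + 1) *
  \sum_(1 <= j < N)
    ((B - B0) * cos (j%:R * pi / N%:R) ^+ 2 + B0)
    / `|sin (j%:R * pi / N%:R)| `^ beta.

Definition rstar (R : realType) (A B B0 alpha beta : R) (N : nat) : R :=
  (Atilde A alpha N / Btilde B B0 beta N) `^ (1 / (alpha - beta)).

(* Only meaningful for s > 1, where the series converges. *)
Definition zeta (R : realType) (s : R) : R := limn (series (riemannR s)).

Definition hbar (R : realType) (A B alpha beta : R) : R :=
  (alpha * A * zeta alpha / (beta * B * zeta beta)) `^ (1 / (alpha - beta)).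

(* [ordS k] is the cyclic successor of k, so that x_N = x_0. *)
Definition next_dist (R : realType) (N : nat) (p : config R N) (k : 'I_N) : R :=
  enorm (pos p k - pos p (ordS k)).

Definition rate (R : realType) (beta : R) (N : nat) : R :=
  if 3 < beta then N%:R ^- 2
  else if beta == 3 then N%:R ^- 2 * ln N%:R
  else N%:R `^ (1 - beta).

(* Main.v *)
(** Along a curve through the ring, the derivative of the energy splits into
    ordered pair contributions that depend only on the half-angle
    [y = (k - l) pi / N].  The part driven by radial displacements is even under
    [y -> pi - y]; everything driven by tangential displacements or by rotations
    of the moments is odd and cancels around the ring.  What is left is a scalar
    radial force, proportional to [Btilde / r^beta - Atilde / r^alpha], which
    vanishes exactly at [rstar].

    For the asymptotics, [(2 rstar sin (pi/N))^(alpha - beta)] is a quotient of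
    sums of powers of [q_j = sin (pi/N) / sin (j pi/N)].  Folding each sum at
    [N/2] and using [1 <= j q_j <= 1 + O((j/N)^2)] compares it with twice the
    zeta series, with error [O(\sum_(j < N/2) j^-beta (j/N)^2 + N^(1 - beta))],
    and this has the order given by [rate].  The term [(B - B0) cos^2 + B0] only
    contributes [B], because [\sum_j sin^2 (j pi/N) q_j^beta] has the same order
    as the error. *)
Require Import Defs.
From HB Require Import structures.
From mathcomp Require Import all_boot all_order all_algebra.
From mathcomp Require Import all_classical all_reals all_analysis.
From mathcomp Require Import ring lra zify.

Import Order.TTheory GRing.Theory Num.Theory.
Import numFieldNormedType.Exports.

Local Open Scope classical_set_scope.
Local Open Scope ring_scope.

(** * Power sums and the tail of the zeta series *)

Lemma ln_ge1BV {R : realType} (x : R) : 0 < x -> 1 - x^-1 <= ln x.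
Proof.
move=> x0; have := @le_ln1Dx R (x^-1 - 1).
rewrite addrCA subrr addr0 lnV ?posrE// => /(_ _); rewrite ltrBrDl subrr invr_gt0.
by move=> /(_ x0); lra.
Qed.

(** The tangent of [expR] at 0, taken at [a * ln x]. Negative [a] serves for decreasing powers. *)
Lemma powR_ge1D {R : realType} (x a : R) : 0 < x -> 1 + a * ln x <= x `^ a.
Proof. by move=> x0; rewrite -[x in x `^ _]lnK ?posrE// -expRM mulrC expR_ge1Dx. Qed.

(** Multiply [1 - z^(-s) <= s ln z <= s (z - 1)] by [z^s]. The factor [z^s] kept on the right lets
    one bound serve all [s >= 0]. *)
Lemma powR_sub1_le {R : realType} (z s : R) : 1 <= z -> 0 <= s ->
  z `^ s - 1 <= s * (z - 1) * z `^ s.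
Proof.
move=> z1 s0; have z0 : 0 < z by lra.
have zs : 0 < z `^ s by exact: powR_gt0.
have := powR_ge1D z (- s) z0; rewrite powRN => h.
have lz : ln z <= z - 1 by have := @le_ln1Dx R (z - 1); rewrite addrCA subrr addr0; apply; lra.
have : 1 - (z `^ s)^-1 <= s * (z - 1).
  by apply: (le_trans (y := s * ln z)); [lra | rewrite ler_wpM2l].
by rewrite -(ler_pM2r zs) mulrBl mulVf ?gt_eqF// mul1r.
Qed.

(** Stands in for the integral of [x^(-p-1)] over [[i, i+1]]: the right side telescopes. It is the
    tangent bound for the exponent [-p] at [i/(i+1)]. *)
Lemma powR_natS_decr {R : realType} (p : R) (i : nat) : 0 < p -> (0 < i)%N ->
  p * i.+1%:R `^ (- p - 1) <= i%:R `^ (- p) - i.+1%:R `^ (- p).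
Proof.
move=> p0 i0; have I0 : 0 < i%:R :> R by rewrite ltr0n.
have J0 : 0 < i.+1%:R :> R by rewrite ltr0n.
have J1 : 0 < i.+1%:R^-1 :> R by rewrite invr_gt0.
have Z0 : 0 < i%:R / i.+1%:R :> R by rewrite divr_gt0.
have := powR_ge1D _ (- p) Z0.
have -> : i%:R / i.+1%:R = 1 + - i.+1%:R^-1 :> R by rewrite -natr1; field; rewrite natr1 gt_eqF.
have hl : ln (1 + - i.+1%:R^-1) <= - i.+1%:R^-1 :> R.
  by apply: le_ln1Dx; rewrite ltrN2 invf_lt1// ltr1n.
move=> h; have {}h : 1 + p / i.+1%:R <= (1 - i.+1%:R^-1) `^ (- p).
  apply: le_trans h; rewrite lerD2l mulNr lerNr -mulrN ler_wpM2l//; exact: ltW.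
have JP : 0 < i.+1%:R `^ (- p) :> R by apply: powR_gt0.
have -> : i%:R = (1 - i.+1%:R^-1) * i.+1%:R :> R by rewrite -natr1; field; rewrite natr1 gt_eqF.
rewrite powRM ?(ltW J0)//; last by rewrite subr_ge0 invf_le1// ler1n.
rewrite powRB; last by rewrite (gt_eqF J0) implybT.
rewrite powRr1 ?(ltW J0)// mulrCA -[X in _ <= _ - X]mul1r -mulrBl mulrC ler_wpM2r ?(ltW JP)//.
by rewrite lerBrDl.
Qed.

(** Telescoping majorant for growing sums. The tangent bound at [(i+1)/i] produces [i^a] instead of
    [(i+1)^a]; the factor [2^a] pays for this, since [i + 1 <= 2 i]. *)
Lemma powR_natS_incr {R : realType} (a : R) (i : nat) : 0 < a -> (0 < i)%N ->
  i.+1%:R `^ (a - 1) <= 2 `^ a / a * (i.+1%:R `^ a - i%:R `^ a).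
Proof.
move=> a0 i0; have I0 : 0 < i%:R :> R by rewrite ltr0n.
have J0 : 0 < i.+1%:R :> R by rewrite ltr0n.
have Z0 : 0 < i.+1%:R / i%:R :> R by rewrite divr_gt0.
have := powR_ge1D _ a Z0; have := ln_ge1BV _ Z0.
rewrite invf_div => hl h.
have hd : 1 - i%:R / i.+1%:R = i.+1%:R^-1 :> R by rewrite -natr1; field; rewrite natr1 gt_eqF.
rewrite hd in hl.
have {}h : 1 + a / i.+1%:R <= (i.+1%:R / i%:R) `^ a.
  by apply: le_trans h; rewrite lerD2l ler_wpM2l// ltW.
have IP : 0 < i%:R `^ a :> R by apply: powR_gt0.
have e : i.+1%:R `^ a = (i.+1%:R / i%:R) `^ a * i%:R `^ a :> R.
  by rewrite -powRM ?(ltW I0) ?(ltW Z0)// divfK ?gt_eqF.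
have {}h : a / i.+1%:R * i%:R `^ a <= i.+1%:R `^ a - i%:R `^ a :> R.
  by rewrite e -[X in _ <= _ - X]mul1r -mulrBl ler_wpM2r ?(ltW IP)// lerBrDl.
have h2 : i.+1%:R `^ a <= 2 `^ a * i%:R `^ a :> R.
  rewrite -powRM ?(ltW I0)// ge0_ler_powR ?nnegrE ?mulr_ge0 ?ler0n//; first exact: ltW.
  by rewrite -natrM ler_nat; lia.
rewrite powRB; last by rewrite (gt_eqF J0) implybT.
rewrite powRr1 ?(ltW J0)// mulrAC ler_pdivlMr// -mulrA [_^-1 * a]mulrC.
apply: (le_trans (y := 2 `^ a * (a / i.+1%:R * i%:R `^ a))); last first.
  by rewrite ler_wpM2l ?powR_ge0.
have -> : 2 `^ a * (a / i.+1%:R * i%:R `^ a) = a / i.+1%:R * (2 `^ a * i%:R `^ a) by ring.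
rewrite [X in X <= _]mulrC; apply: ler_wpM2l h2; exact: divr_ge0 (ltW a0) (ltW J0).
Qed.

Lemma invr_natS_le {R : realType} (i : nat) : (0 < i)%N ->
  i.+1%:R^-1 <= ln i.+1%:R - ln i%:R :> R.
Proof.
move=> i0; have I0 : 0 < i%:R :> R by rewrite ltr0n.
have J0 : 0 < i.+1%:R :> R by rewrite ltr0n.
rewrite -ln_div ?posrE//; apply: le_trans (ln_ge1BV _ (divr_gt0 J0 I0)).
by rewrite invf_div le_eqVlt -natr1; apply/orP; left; apply/eqP; field; rewrite natr1 gt_eqF.
Qed.

Lemma sum_powRN_le {R : realType} (s : R) (m n : nat) : 1 < s -> (0 < m)%N ->
  \sum_(m <= j < n) j%:R `^ (- s) <= s / (s - 1) * m%:R `^ (1 - s).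
Proof.
move=> s1 m0; have M0 : 0 < m%:R :> R by rewrite ltr0n.
have s0 : 0 < s - 1 by rewrite subr_gt0.
have rhs0 : 0 <= s / (s - 1) * m%:R `^ (1 - s).
  by rewrite mulr_ge0 ?powR_ge0// divr_ge0//; lra.
have [nm|mn] := leqP n m; first by rewrite big_geq.
(* The first term is kept apart and the others telescope, down to [(k-1)^(1-s)] because the sum
   stops at [k - 1]. *)
have step k : (m < k)%N -> \sum_(m <= j < k) j%:R `^ (- s)
    <= m%:R `^ (- s) + (s - 1)^-1 * (m%:R `^ (1 - s) - (k.-1)%:R `^ (1 - s)).
  elim: k => // k IH; rewrite ltnS leq_eqVlt => /predU1P[<-|mk].
    by rewrite big_nat1 /= subrr mulr0 addr0.
  have k0 : (0 < k.-1)%N by lia.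
  have := powR_natS_decr (s - 1) _ s0 k0.
  rewrite prednK; last lia.
  have e : 1 - s - 1 = - s by ring.
  rewrite opprB e => h.
  rewrite big_nat_recr/=; last lia.
  apply: (le_trans (lerD (IH mk) (lexx _))).
  rewrite -addrA lerD2l.
  have -> : m%:R `^ (1 - s) - k%:R `^ (1 - s) =
    (m%:R `^ (1 - s) - k.-1%:R `^ (1 - s)) + (k.-1%:R `^ (1 - s) - k%:R `^ (1 - s)) by ring.
  by rewrite [in X in _ <= X]mulrDr lerD2l ler_pdivlMl.
apply: (le_trans (step n mn)).
(* The first term joins the telescoped part: [1 + 1/(s-1) = s/(s-1)]. *)
have h1 : m%:R `^ (- s) <= m%:R `^ (1 - s) :> R.
  by apply: ler_powR; [rewrite ler1n|lra].
have -> : s / (s - 1) = 1 + (s - 1)^-1 by field; rewrite gt_eqF.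
rewrite mulrDl mul1r lerD//; apply: ler_wpM2l; first by rewrite invr_ge0 ltW.
by rewrite gerBl powR_ge0.
Qed.

Lemma series_riemannR {R : realType} (s : R) (n : nat) :
  series (riemannR s) n = \sum_(1 <= j < n.+1) j%:R `^ (- s).
Proof.
rewrite /series /= big_add1; apply: eq_bigr => i _.
by rewrite /riemannR powRN.
Qed.

Lemma cvg_series_riemannR {R : realType} (s : R) : 1 < s ->
  cvgn (series (riemannR s)).
Proof.
move=> s1; apply: nondecreasing_is_cvgn.
  apply: nondecreasing_series => n _ _; apply/ltW/riemannR_gt0; lra.
exists (s / (s - 1) * 1%:R `^ (1 - s)) => _ [n _ <-].
by rewrite series_riemannR; exact: sum_powRN_le.
Qed.

(** Partial sums increase to [zeta s], so the absolute value opens; the uniform bound on finite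
    blocks starting at [m] passes to the limit. *)
Lemma zeta_tail {R : realType} (s : R) (m : nat) : 1 < s -> (0 < m)%N ->
  `|zeta s - \sum_(1 <= j < m) j%:R `^ (- s)| <= s / (s - 1) * m%:R `^ (1 - s).
Proof.
move=> s1 m0; have cv := cvg_series_riemannR _ s1.
have nd : nondecreasing_seq (series (riemannR s)).
  apply: nondecreasing_series => n _ _; apply/ltW/riemannR_gt0; lra.
have -> : m = m.-1.+1 by lia.
rewrite -series_riemannR ger0_norm; last first.
  by rewrite subr_ge0 /zeta; exact: nondecreasing_cvgn_le.
rewrite lerBlDr; apply: limr_le => //; near=> n.
rewrite !series_riemannR (@big_cat_nat _ _ _ m.-1.+1)//=; last by rewrite ltnS; near: n; exists m.-1.
rewrite addrC lerD2r; exact: sum_powRN_le.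
Unshelve. all: by end_near. Qed.

Lemma sum_powR_le {R : realType} (a : R) (n : nat) : 0 < a ->
  \sum_(1 <= j < n.+1) j%:R `^ (a - 1) <= (1 + 2 `^ a / a) * n%:R `^ a.
Proof.
move=> a0; have c0 : 0 <= 2 `^ a / a by rewrite divr_ge0 ?powR_ge0// ltW.
elim: n => [|n IH]; first by rewrite big_geq// mulr_ge0 ?powR_ge0 ?addr_ge0.
have [->|n0] := posnP n; first by rewrite big_nat1 !powR1 mulr1 lerDl.
rewrite big_nat_recr//=; apply: (le_trans (lerD IH (powR_natS_incr _ _ a0 n0))).
have : n%:R `^ a <= n.+1%:R `^ a :> R.
  by apply: ge0_ler_powR; rewrite ?(ltW a0) ?nnegrE ?ler0n ?ler_nat.
by move: (2 `^ a / a) (n%:R `^ a) (n.+1%:R `^ a) => c x y; lra.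
Qed.

Lemma sum_invr_le {R : realType} (n : nat) : (0 < n)%N ->
  \sum_(1 <= j < n.+1) j%:R^-1 <= 1 + ln n%:R :> R.
Proof.
elim: n => // n IH _.
have [->|n0] := posnP n; first by rewrite big_nat1 invr1 ln1 addr0.
rewrite big_nat_recr//=; apply: (le_trans (lerD (IH n0) (invr_natS_le _ n0))).
by rewrite -addrA [X in _ + X]addrC subrK.
Qed.

(** * Power sums compared with the rate *)

Lemma rate_ge0 {R : realType} (beta : R) (N : nat) : (2 <= N)%N -> 0 <= rate beta N.
Proof.
move=> N2; rewrite /rate; case: ifP => _; first by rewrite invr_ge0 exprn_ge0 ?ler0n.
case: ifP => _; last exact: powR_ge0.
rewrite mulr_ge0 ?invr_ge0 ?exprn_ge0 ?ler0n// ln_ge0// ler1n; lia.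
Qed.

(** Turns estimates in [rate] into bounds valid for all [N >= 2], not just for large [N]. *)
Lemma rate_le1 {R : realType} (beta : R) (N : nat) : 1 < beta -> (2 <= N)%N ->
  rate beta N <= 1.
Proof.
move=> b1 N2; have N1 : 1 <= N%:R :> R by rewrite ler1n; lia.
have N0 : 0 < N%:R :> R by rewrite ltr0n; lia.
rewrite /rate; case: ifP => _; first by rewrite invf_le1 ?exprn_gt0// exprn_ege1.
case: ifP => _.
  rewrite mulrC ler_pdivrMr ?exprn_gt0// mul1r expr2.
  apply: (le_trans (ltW (ln_sublinear N0))); rewrite ler_peMr//; exact: ltW.
by rewrite -[leRHS](powRr0 N%:R); apply: ler_powR => //; lra.
Qed.

(** For [beta >= 3] the left side is at most [N^(-2)]; at [beta = 3] the logarithm is restored from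
    [ln N >= ln 2], whence the constant. *)
Lemma powR_le_rate {R : realType} (beta : R) :
  exists2 C : R, 0 < C & forall N, (2 <= N)%N -> N%:R `^ (1 - beta) <= C * rate beta N.
Proof.
have l2 : 0 < ln 2 :> R by rewrite ln_gt0// ltr1n.
exists (1 + (ln 2)^-1); first by rewrite ltr_wpDr// invr_ge0 ltW.
move=> N N2; have N1 : 1 <= N%:R :> R by rewrite ler1n; lia.
have N0 : 0 < N%:R :> R by rewrite ltr0n; lia.
have big x : 0 <= x -> x <= (1 + (ln 2)^-1) * x :> R.
  by move=> x0; rewrite ler_peMl// lerDl invr_ge0 ltW.
rewrite /rate; case: ifPn => [b3|_].
  have -> : N%:R ^- 2 = N%:R `^ (- 2%:R) :> R by rewrite powR_invn ?(ltW N0).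
  by apply: (le_trans _ (big _ (powR_ge0 _ _))); apply: ler_powR => //; lra.
case: ifPn => [/eqP ->|_]; last exact: big (powR_ge0 _ _).
have -> : 1 - 3 = - 2%:R :> R by ring.
rewrite powR_invn ?(ltW N0)// mulrCA ler_peMr ?invr_ge0 ?exprn_ge0 ?(ltW N0)//.
have h : ln 2 <= ln N%:R :> R by rewrite ler_ln ?posrE// ler_nat.
rewrite mulrDl mul1r -[leLHS]add0r lerD//; first exact: (le_trans (ltW l2) h).
by rewrite mulrC ler_pdivlMr// mul1r.
Qed.

(** The three regimes of [rate] come from this sum: bounded for [beta > 3], harmonic at [beta = 3],
    at most of order [N^(3 - beta)] below. *)
Lemma sum_powR_le_rate {R : realType} (beta : R) :
  exists2 C : R, 0 < C & forall N, (2 <= N)%N ->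
    N%:R ^- 2 * \sum_(1 <= j < N.+1) j%:R `^ (2 - beta) <= C * rate beta N.
Proof.
have [b3|b3] := boolP (3 < beta).
  exists ((beta - 2) / (beta - 3)) => [|N N2]; first by rewrite divr_gt0 ?subr_gt0//; lra.
  rewrite /rate b3 mulrC; apply: ler_wpM2r; first by rewrite invr_ge0 exprn_ge0.
  have h := @sum_powRN_le R (beta - 2) 1 N.+1.
  rewrite opprB powR1 mulr1 in h; have -> : beta - 3 = beta - 2 - 1 by ring.
  by apply: h => //; lra.
have [b3'|b3'] := eqVneq beta 3.
  have l2 : 0 < ln 2 :> R by rewrite ln_gt0// ltr1n.
  exists (1 + (ln 2)^-1) => [|N N2]; first by rewrite ltr_wpDr// invr_ge0 ltW.
  rewrite /rate (negbTE b3) b3' eqxx mulrCA; apply: ler_wpM2l; first by rewrite invr_ge0 exprn_ge0.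
  have h : ln 2 <= ln N%:R :> R by rewrite ler_ln ?posrE ?ltr0n ?ler_nat//; lia.
  apply: (le_trans (y := 1 + ln N%:R)).
    rewrite (eq_bigr (fun j : nat => j%:R^-1)); first by apply: sum_invr_le; lia.
    move=> j _; have -> : 2 - 3 = - 1 :> R by ring.
    by rewrite powR_inv1.
  by rewrite mulrDl mul1r addrC lerD2l mulrC ler_pdivlMr// mul1r.
have a0 : 0 < 3 - beta by rewrite subr_gt0 lt_neqAle b3' leNgt.
exists (1 + 2 `^ (3 - beta) / (3 - beta)) => [|N N2].
  by rewrite ltr_wpDr// divr_ge0 ?powR_ge0// ltW.
have N0 : 0 < N%:R :> R by rewrite ltr0n; lia.
rewrite /rate (negbTE b3) (negbTE b3').
have -> : N%:R `^ (1 - beta) = N%:R `^ (3 - beta) / N%:R ^+ 2.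
  rewrite -powR_mulrn ?(ltW N0)// -powRB ?(gt_eqF N0) ?implybT//.
  by congr (_ `^ _); ring.
rewrite mulrA mulrC.
apply: ler_wpM2r; first by rewrite invr_ge0 exprn_ge0.
have -> : 2 - beta = (3 - beta) - 1 by ring.
exact: sum_powR_le.
Qed.

(** The error over half a ring: the second-order correction of the chords plus the zeta tail. The
    condition on [m] covers both halves of a folded ring, for even and odd [N]. *)
Lemma weighted_sum_le_rate {R : realType} (beta : R) : 1 < beta ->
  exists2 C : R, 0 < C & forall N m, (2 <= N)%N -> (m <= N <= 2 * m)%N ->
    \sum_(1 <= j < m) j%:R `^ (- beta) * (j%:R / N%:R) ^+ 2 + m%:R `^ (1 - beta)
    <= C * rate beta N.
Proof.
move=> b1; have [C1 C10 h1] := powR_le_rate beta.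
have [C2 C20 h2] := sum_powR_le_rate beta.
exists (C2 + 2 `^ (beta - 1) * C1); first by rewrite addr_gt0// mulr_gt0// powR_gt0.
move=> N m N2 /andP[mN Nm].
have N0 : 0 < N%:R :> R by rewrite ltr0n; lia.
have M0 : 0 < m%:R :> R by rewrite ltr0n; lia.
rewrite mulrDl lerD//.
  apply: le_trans (h2 N N2); rewrite mulr_sumr [leRHS](@big_cat_nat _ _ _ m)//=; last 2 first.
  - lia.
  - lia.
  rewrite -[leLHS]addr0 lerD//; last first.
    by apply: sumr_ge0 => j _; rewrite mulr_ge0 ?powR_ge0// invr_ge0 exprn_ge0.
  rewrite le_eqVlt; apply/orP; left; apply/eqP; rewrite !big_nat; apply: eq_bigr => j /andP[j1 _].
  have J0 : 0 < j%:R :> R by rewrite ltr0n.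
  rewrite powRD ?(gt_eqF J0) ?implybT// powR_mulrn ?(ltW J0)//.
  by rewrite expr_div_n; move: (N%:R ^- 2) (j%:R `^ (- beta)) => x y; ring.
(* Since [1 - beta < 0], the bound [m >= N/2] costs the factor [2^(beta - 1)]. *)
rewrite -mulrA; apply: (le_trans _ (ler_wpM2l (powR_ge0 _ _) (h1 N N2))).
rewrite -[beta - 1]opprB powRN mulrC ler_pdivlMr ?powR_gt0// -powRM ?(ltW M0)//.
rewrite -[1 - beta]opprB !powRN lef_pV2 ?posrE ?powR_gt0 ?mulr_gt0//.
apply: ge0_ler_powR; rewrite ?nnegrE ?mulr_ge0 ?ler0n//; first lra.
by rewrite mulrC -natrM ler_nat.
Qed.

(** * Chord ratios *)

Lemma sin_MVT0 {R : realType} (x : R) : 0 <= x ->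
  exists2 c, c \in `[0, x] & sin x = cos c * x.
Proof.
move=> x0; have [|c cx] := @MVT_segment R sin cos 0 x x0 (fun y _ => is_derive_sin y).
  by apply: continuous_subspaceT => y; exact: continuous_sin.
by rewrite sin0 !subr0 => e; exists c.
Qed.

Lemma sin_le_id {R : realType} (x : R) : 0 <= x -> sin x <= x.
Proof.
by move=> x0; have [c _ ->] := sin_MVT0 _ x0; rewrite ler_piMl// cos_le1.
Qed.

Lemma xcos_le_sin {R : realType} (x : R) : 0 <= x <= pi -> x * cos x <= sin x.
Proof.
move=> /andP[x0 xpi]; have [c] := sin_MVT0 _ x0.
rewrite in_itv/= => /andP[c0 cx] ->; rewrite mulrC ler_wpM2r//.
have [->//|cnx] := eqVneq c x.
apply: ltW; rewrite ltr_cos ?in_itv/= ?x0 ?xpi ?c0 ?(le_trans cx)//.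
by rewrite lt_neqAle cnx.
Qed.

(** Take [x cos x <= sin x] at [x/2] and multiply by [2 cos (x/2)]; the factor [(1 + cos x)/2] is
    [cos^2 (x/2)]. It is still [1/2] at [pi/2], where [cos] vanishes. *)
Lemma sin_ge_halfangle {R : realType} (x : R) : 0 <= x <= pi ->
  x * ((1 + cos x) / 2) <= sin x.
Proof.
move=> /andP[x0 xpi].
have h : x / 2 * cos (x / 2) <= sin (x / 2).
  apply: xcos_le_sin; rewrite divr_ge0//= ler_pdivrMr//; apply: (le_trans xpi).
  by rewrite ler_peMr ?pi_ge0// ler1n.
have c0 : 0 <= cos (x / 2) by apply: cos_ge0_pihalf; have := @pi_ge0 R; lra.
have e : x = (x / 2) *+ 2 by rewrite mulr2n -splitr.
rewrite [in cos x]e [in leRHS]e sin_mulr2n cos_mulr2n.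
have -> : (1 + (cos (x / 2) ^+ 2 *+ 2 - 1)) / 2 = cos (x / 2) ^+ 2 by field.
have -> : x * cos (x / 2) ^+ 2 = (cos (x / 2) * (x / 2 * cos (x / 2))) *+ 2 by field.
by rewrite lerMn2r/= ler_wpM2l.
Qed.

Lemma one_sub_cos_le {R : realType} (x : R) : 0 <= x -> 1 - cos x <= x ^+ 2 / 2.
Proof.
move=> x0; have e : x = (x / 2) *+ 2 by rewrite mulr2n -splitr.
rewrite [in cos x]e cos_mulr2n cos2sin2.
have h : `|sin (x / 2)| <= `|x / 2|.
  rewrite [leRHS]ger0_norm ?divr_ge0// ler_norml; have [c _ ->] := sin_MVT0 _ (divr_ge0 x0 (ler0n _ 2)).
  have x20 : 0 <= x / 2 by rewrite divr_ge0.
  by rewrite ler_piMl ?cos_le1// andbT -mulN1r ler_wpM2r// cos_geN1.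
have : sin (x / 2) ^+ 2 <= (x / 2) ^+ 2 by rewrite -real_normK ?num_real// -[leRHS]real_normK ?num_real// lerXn2r ?nnegrE.
by rewrite expr_div_n => h2; lra.
Qed.

Lemma norm_sin_natmul {R : realType} (j : nat) (x : R) :
  `|sin (j%:R * x)| <= j%:R * `|sin x|.
Proof.
elim: j => [|j IH]; first by rewrite !mul0r sin0 normr0.
rewrite -natr1 !mulrDl !mul1r sinD; apply: (le_trans (ler_normD _ _)).
rewrite !normrM lerD// ?ler_piMl ?cos_max// (le_trans _ IH)// ler_piMr ?cos_max//.
Qed.

Lemma sin_frac_gt0 {R : realType} (N j : nat) : (0 < j < N)%N ->
  0 < sin (j%:R * pi / N%:R) :> R.
Proof.
move=> /andP[j0 jN]; apply: sin_gt0_pi.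
have N0 : 0 < N%:R :> R by rewrite ltr0n; lia.
apply/andP; split; first by rewrite divr_gt0// mulr_gt0 ?pi_gt0// ltr0n.
by rewrite ltr_pdivrMr// mulrC ltr_pM2l ?pi_gt0// ltr_nat.
Qed.

(** The side of the regular [N]-gon divided by the chord spanning [j] sides. *)
Definition chord_ratio {R : realType} (N j : nat) : R :=
  sin (pi / N%:R) / sin (j%:R * pi / N%:R).

(** With [a = j pi/N <= pi/2]: [sin (j x) <= j sin x] gives the lower bound, and [j sin (pi/N) <= a
    <= 2 sin a / (1 + cos a)] gives both upper ones. *)
Lemma chord_ratio_bounds {R : realType} (N j : nat) : (0 < j)%N -> (2 * j <= N)%N ->
  [/\ 1 <= j%:R * chord_ratio N j :> R, j%:R * chord_ratio N j <= 2 :> R &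
      j%:R * chord_ratio N j <= 1 + pi ^+ 2 / 2 * (j%:R / N%:R) ^+ 2 :> R].
Proof.
move=> j0 jN; rewrite /chord_ratio mulrA.
have N0 : 0 < N%:R :> R by rewrite ltr0n; lia.
have J0 : 0 < j%:R :> R by rewrite ltr0n.
have s0 : 0 < sin (j%:R * pi / N%:R) :> R by apply: sin_frac_gt0; lia.
have x0 : 0 < pi / N%:R :> R by rewrite divr_gt0 ?pi_gt0.
have s1 : 0 < sin (pi / N%:R) :> R.
  by have := @sin_frac_gt0 R N 1; rewrite mul1r; apply; lia.
set a := j%:R * pi / N%:R in s0 *.
have ea : a = j%:R * (pi / N%:R) by rewrite /a mulrA.
have a0 : 0 < a by rewrite ea mulr_gt0.
have a2 : a <= pi / 2.
  rewrite /a ler_pdivrMr// mulrC -mulrA ler_wpM2l ?pi_ge0// ler_pdivlMl// -natrM ler_nat//.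
have hj : j%:R * sin (pi / N%:R) <= a.
  by rewrite ea; apply: ler_wpM2l; [exact: ltW | apply/sin_le_id/ltW].
have hs : a * ((1 + cos a) / 2) <= sin a.
  by apply: sin_ge_halfangle; have := @pi_ge0 R; lra.
have c0 : 0 <= cos a by apply: cos_ge0_pihalf; lra.
have c1 := @cos_le1 R a.
have key : j%:R * sin (pi / N%:R) / sin a <= ((1 + cos a) / 2)^-1.
  rewrite ler_pdivrMr// ler_pdivlMl; last lra.
  apply: (le_trans _ hs); rewrite mulrC ler_wpM2r//; lra.
split.
- rewrite ler_pdivlMr// mul1r.
  have := norm_sin_natmul j (pi / N%:R : R).
  by rewrite -ea !gtr0_norm.
- apply: (le_trans key); rewrite invf_ple ?posrE//; lra.
apply: (le_trans key).
have -> : pi ^+ 2 / 2 * (j%:R / N%:R) ^+ 2 = a ^+ 2 / 2 :> R.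
  by rewrite /a !expr_div_n exprMn; field; rewrite gt_eqF.
apply: (le_trans (y := 1 + (1 - cos a))); last first.
  by rewrite lerD2l; apply/one_sub_cos_le/ltW.
(* With [c = cos a] in [[0, 1]] this is [2 <= (2 - c) (1 + c)], that is [c^2 <= c]. *)
rewrite -[leLHS]mul1r ler_pdivrMr; last lra.
nra.
Qed.

Lemma chord_ratio_ge0 {R : realType} (N j : nat) : (0 < j < N)%N ->
  0 <= chord_ratio N j :> R.
Proof.
move=> jN; rewrite divr_ge0//; last exact/ltW/sin_frac_gt0.
have := @sin_frac_gt0 R N 1; rewrite mul1r => h; apply/ltW/h; lia.
Qed.

(** Factor [q_j^s = j^(-s) (j q_j)^s], where [j q_j] lies in [[1, 2]] and within [O((j/N)^2)] of
    1. *)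
Lemma powR_chord_ratio {R : realType} (s : R) (N j : nat) : 0 <= s ->
  (0 < j)%N -> (2 * j <= N)%N ->
  chord_ratio N j `^ s <= 2 `^ s * j%:R `^ (- s) /\
  `|chord_ratio N j `^ s - j%:R `^ (- s)| <=
    s * 2 `^ s * (pi ^+ 2 / 2) * (j%:R `^ (- s) * (j%:R / N%:R) ^+ 2).
Proof.
move=> s0 j0 jN; have [h1 h2 h3] := @chord_ratio_bounds R _ _ j0 jN.
have J0 : 0 < j%:R :> R by rewrite ltr0n.
have JP : 0 < j%:R `^ (- s) :> R by apply: powR_gt0.
have q0 : 0 <= chord_ratio N j :> R by apply: chord_ratio_ge0; lia.
have y0 : 0 <= j%:R * chord_ratio N j :> R by rewrite mulr_ge0 ?ler0n.
have e : chord_ratio N j `^ s = j%:R `^ (- s) * (j%:R * chord_ratio N j) `^ s.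
  by rewrite powRM ?ler0n// mulrA powRN mulVf ?mul1r// gt_eqF// powR_gt0.
have y2 : (j%:R * chord_ratio N j) `^ s <= 2 `^ s :> R.
  by apply: ge0_ler_powR => //; rewrite nnegrE.
have ys1 : 1 <= (j%:R * chord_ratio N j) `^ s :> R.
  by have := ge0_ler_powR s0 _ _ h1; rewrite powR1 !nnegrE; apply.
split; first by rewrite e mulrC ler_wpM2r// ltW.
rewrite e -[X in _ - X]mulr1 -mulrBr normrM gtr0_norm//.
rewrite [leRHS]mulrCA; apply: ler_wpM2l; first exact: ltW.
rewrite ger0_norm ?subr_ge0//; apply: (le_trans (powR_sub1_le _ _ h1 s0)).
rewrite -!mulrA; apply: ler_wpM2l => //; rewrite [leLHS]mulrC; apply: ler_pM => //.
- exact: powR_ge0.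
- by rewrite subr_ge0.
- by rewrite lerBlDl 2!mulrA -expr2.
Qed.

Lemma chord_ratio_rev {R : realType} (N j : nat) : (0 < j < N)%N ->
  chord_ratio N (N - j) = chord_ratio N j :> R.
Proof.
move=> jN; rewrite /chord_ratio; congr (_ / _).
rewrite natrB; last lia.
have -> : (N%:R - j%:R) * pi / N%:R = - (j%:R * pi / N%:R) + pi :> R.
  by field; rewrite pnatr_eq0; lia.
by rewrite sinDpi sinN opprK.
Qed.

(** The second sum is the reflection of the indices above [N/2]. For even [N] the middle index is
    counted in the first sum only. *)
Lemma sum_symmetric_split {V : nmodType} (f : nat -> V) (N : nat) : (2 <= N)%N ->
  (forall j, (0 < j < N)%N -> f (N - j)%N = f j) ->
  \sum_(1 <= j < N) f j =
  \sum_(1 <= j < (N./2).+1) f j + \sum_(1 <= j < N - N./2) f j.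
Proof.
move=> N2 fs; have h : (N./2 < N)%N by lia.
rewrite (@big_cat_nat _ _ _ (N./2).+1)//=; congr (_ + _).
rewrite [RHS]big_nat_rev -[in LHS]add1n [LHS]big_addn/=.
rewrite [LHS]big_nat [RHS]big_nat; apply: eq_bigr => i hi.
rewrite -fs; last lia.
by congr f; lia.
Qed.

(** * Ring sums and zeta values *)

Lemma zeta_ge1 {R : realType} (s : R) : 1 < s -> 1 <= zeta s.
Proof.
move=> s1; have nd : nondecreasing_seq (series (riemannR s)).
  by apply: nondecreasing_series => n _ _; apply/ltW/riemannR_gt0; lra.
have := nondecreasing_cvgn_le nd (cvg_series_riemannR _ s1) 1%N.
by rewrite series_riemannR big_nat1 powR1.
Qed.

(** Replace [q_j^s] by [j^(-s)], then complete the zeta series by its tail. As [s >= beta], both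
    errors are dominated, up to constants, by those at exponent [beta], so the sum at [alpha] obeys
    [rate beta] too. *)
Lemma half_ring_sum_zeta {R : realType} (beta s : R) : 1 < beta -> beta <= s ->
  exists2 C : R, 0 < C & forall N m, (2 <= N)%N -> (m <= N <= 2 * m)%N ->
    (2 * m.-1 <= N)%N ->
    `|\sum_(1 <= j < m) chord_ratio N j `^ s - zeta s| <= C * rate beta N.
Proof.
move=> b1 bs; have [C C0 hC] := weighted_sum_le_rate _ b1.
pose K := s * 2 `^ s * (pi ^+ 2 / 2) : R.
have s1 : 1 < s by lra.
have s0 : 0 <= s by lra.
have K0 : 0 <= K by rewrite !mulr_ge0 ?powR_ge0 ?exprn_ge0 ?pi_ge0 ?invr_ge0.
have c0 : 0 < s / (s - 1) by rewrite divr_gt0 ?subr_gt0//; lra.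
exists ((K + s / (s - 1)) * C); first by rewrite mulr_gt0// ltr_wpDl.
move=> N m N2 mN mN2; have := hC N m N2 mN.
have m0 : (0 < m)%N by lia.
set E := \sum_(1 <= j < m) (_ * _) => hE.
have pos j : 0 <= j%:R `^ (- beta) * (j%:R / N%:R) ^+ 2 :> R.
  by rewrite mulr_ge0 ?powR_ge0// exprn_ge0// divr_ge0.
have E0 : 0 <= E by apply: sumr_ge0 => j _; exact: pos.
rewrite -mulrA; apply: (le_trans _ (ler_wpM2l (addr_ge0 K0 (ltW c0)) hE)).
have tail : m%:R `^ (1 - s) <= m%:R `^ (1 - beta) :> R.
  by apply: ler_powR; [rewrite ler1n|lra].
have sum : `|\sum_(1 <= j < m) chord_ratio N j `^ s - \sum_(1 <= j < m) j%:R `^ (- s)|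
    <= K * E.
  rewrite -sumrB; apply: (le_trans (ler_norm_sum _ _ _)).
  rewrite mulr_sumr !big_nat; apply: ler_sum => j /andP[j1 jm].
  have [|_] := @powR_chord_ratio R s N j s0 j1; first lia.
  move=> /le_trans; apply; apply: ler_wpM2l => //.
  apply: ler_wpM2r; first by rewrite exprn_ge0// divr_ge0.
  by apply: ler_powR; [rewrite ler1n|lra].
have zt := zeta_tail _ _ s1 m0; rewrite distrC in zt.
have -> : \sum_(1 <= j < m) chord_ratio N j `^ s - zeta s =
  (\sum_(1 <= j < m) chord_ratio N j `^ s - \sum_(1 <= j < m) j%:R `^ (- s)) +
  (\sum_(1 <= j < m) j%:R `^ (- s) - zeta s) by rewrite addrA subrK.
apply: (le_trans (ler_normD _ _)).
apply: (le_trans (lerD sum (le_trans zt (ler_wpM2l (ltW c0) tail)))).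
have p0 : 0 <= m%:R `^ (1 - beta) :> R by exact: powR_ge0.
rewrite mulrDl !mulrDr -!addrA lerD2l addrA lerDr.
by apply: addr_ge0; apply: mulr_ge0 => //; exact: ltW.
Qed.

Lemma ring_sum_zeta {R : realType} (beta s : R) : 1 < beta -> beta <= s ->
  exists2 C : R, 0 < C & forall N, (2 <= N)%N ->
    `|\sum_(1 <= j < N) chord_ratio N j `^ s - 2 * zeta s| <= C * rate beta N.
Proof.
move=> b1 bs; have [C C0 hC] := half_ring_sum_zeta _ _ b1 bs.
exists (C + C) => [|N N2]; first exact: addr_gt0.
rewrite sum_symmetric_split//; last by move=> j jN; rewrite chord_ratio_rev.
have -> : 2 * zeta s = zeta s + zeta s by ring.
rewrite [in leRHS]mulrDl opprD addrACA.
by apply: (le_trans (ler_normD _ _)); apply: lerD; apply: hC => //; lia.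
Qed.

(** On each half, [sin^2 (j pi/N) <= pi^2 (j/N)^2] and [q_j^beta <= 2^beta j^(-beta)] lead back to
    the weighted sum. *)
Lemma ring_sum_sin2 {R : realType} (beta : R) : 1 < beta ->
  exists2 C : R, 0 < C & forall N, (2 <= N)%N ->
    \sum_(1 <= j < N) sin (j%:R * pi / N%:R) ^+ 2 * chord_ratio N j `^ beta
    <= C * rate beta N.
Proof.
move=> b1; have [C C0 hC] := weighted_sum_le_rate _ b1.
pose K := 2 `^ beta * pi ^+ 2 : R.
have K0 : 0 < K by rewrite mulr_gt0 ?powR_gt0// exprn_gt0// pi_gt0.
have half N m : (2 <= N)%N -> (m <= N <= 2 * m)%N -> (2 * m.-1 <= N)%N ->
    \sum_(1 <= j < m) sin (j%:R * pi / N%:R) ^+ 2 * chord_ratio N j `^ beta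
    <= K * C * rate beta N.
  move=> N2 mN mN2; rewrite -mulrA; apply: (le_trans _ (ler_wpM2l (ltW K0) (hC N m N2 mN))).
  rewrite mulrDr -[leLHS]addr0 lerD//; last by rewrite mulr_ge0 ?powR_ge0// ltW.
  rewrite mulr_sumr !big_nat; apply: ler_sum => j /andP[j1 jm].
  have [||h _] := @powR_chord_ratio R beta N j _ j1; [lra|lia|].
  have s0 : 0 <= sin (j%:R * pi / N%:R) :> R by apply/ltW/sin_frac_gt0; lia.
  have a0 : 0 <= j%:R * pi / N%:R :> R by rewrite divr_ge0 ?mulr_ge0 ?pi_ge0.
  have h2 : sin (j%:R * pi / N%:R) ^+ 2 <= pi ^+ 2 * (j%:R / N%:R) ^+ 2 :> R.
    by rewrite -exprMn mulrA [pi * _]mulrC lerXn2r ?nnegrE// sin_le_id.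
  apply: (le_trans (ler_pM (exprn_ge0 _ s0) (powR_ge0 _ _) h2 h)).
  rewrite le_eqVlt; apply/orP; left; apply/eqP; rewrite /K.
  by move: (j%:R / N%:R) (j%:R `^ (- beta)) => x y; ring.
exists (K * C + K * C) => [|N N2]; first by rewrite addr_gt0// mulr_gt0.
rewrite sum_symmetric_split//; last first.
  move=> j jN; rewrite chord_ratio_rev//; congr (_ ^+ 2 * _).
  rewrite natrB; last lia.
  have -> : (N%:R - j%:R) * pi / N%:R = - (j%:R * pi / N%:R) + pi :> R.
    by field; rewrite pnatr_eq0; lia.
  by rewrite sinDpi sinN opprK.
by rewrite mulrDl lerD//; apply: half => //; lia.
Qed.

(** For [y <= x], write [x^g - y^g = y^g ((x/y)^g - 1)] and apply [powR_sub1_le] to the ratio.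
    Exponents below and above 1 are treated alike. *)
Lemma powR_lipschitz {R : realType} (g m M x y : R) : 0 <= g -> 0 < m ->
  m <= x <= M -> m <= y <= M -> `|x `^ g - y `^ g| <= g * M `^ g / m * `|x - y|.
Proof.
move=> g0 m0; wlog yx : x y / y <= x => [h|].
  move=> hx hy; have [yx|/ltW xy] := leP y x; first exact: h.
  by rewrite distrC [`|x - y|]distrC; exact: h.
move=> /andP[mx xM] /andP[my yM].
have x0 : 0 < x by lra.
have y0 : 0 < y by lra.
have le : y `^ g <= x `^ g by apply: ge0_ler_powR; rewrite ?nnegrE ?(ltW x0) ?(ltW y0).
have xMg : x `^ g <= M `^ g.
  by apply: ge0_ler_powR; rewrite ?nnegrE ?(ltW x0)//; lra.
rewrite !ger0_norm ?subr_ge0//.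
have z1 : 1 <= x / y by rewrite ler_pdivlMr// mul1r.
have e : x `^ g = y `^ g * (x / y) `^ g.
  by rewrite -powRM ?divr_ge0 ?(ltW x0) ?(ltW y0)// mulrC divfK// gt_eqF.
have -> : x `^ g - y `^ g = y `^ g * ((x / y) `^ g - 1) by rewrite mulrBr -e mulr1.
apply: (le_trans (ler_wpM2l (powR_ge0 _ _) (powR_sub1_le _ _ z1 g0))).
have -> : y `^ g * (g * (x / y - 1) * (x / y) `^ g) = g * (x - y) * (x `^ g / y).
  by rewrite e; field; rewrite gt_eqF.
have -> : g * M `^ g / m * (x - y) = g * (x - y) * (M `^ g / m) by ring.
apply: ler_wpM2l; first by rewrite mulr_ge0// subr_ge0.
by apply: ler_pM; rewrite ?powR_ge0 ?invr_ge0 ?(ltW y0)// lef_pV2.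
Qed.

(** * The rescaled equilibrium radius *)

Lemma powR_invr {R : realType} (x p : R) : 0 <= x -> x^-1 `^ p = (x `^ p)^-1.
Proof. by move=> x0; rewrite -(powR_inv1 x0) -powRrM -powRN mulNr mul1r. Qed.

(* [Btilde] rescaled: [beta / 2 * attraction = Btilde * (2 sin (pi/N))^beta]. *)
Definition attraction {R : realType} (B B0 beta : R) (N : nat) : R :=
  \sum_(1 <= j < N) ((B - B0) * cos (j%:R * pi / N%:R) ^+ 2 + B0) *
    chord_ratio N j `^ beta.

Lemma sin_piV_gt0 {R : realType} (N : nat) : (2 <= N)%N -> 0 < sin (pi / N%:R) :> R.
Proof. by move=> N2; have := @sin_frac_gt0 R N 1; rewrite mul1r; apply; lia. Qed.

Lemma chord_ratio1 {R : realType} (N : nat) : (2 <= N)%N -> chord_ratio N 1 = 1 :> R.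
Proof. by move=> N2; rewrite /chord_ratio mul1r divff// gt_eqF// sin_piV_gt0. Qed.

Lemma chord_ratio_sum_ge1 {R : realType} (s : R) (N : nat) : (2 <= N)%N ->
  1 <= \sum_(1 <= j < N) chord_ratio N j `^ s.
Proof.
move=> N2; rewrite big_ltn; last lia.
rewrite chord_ratio1// powR1 lerDl sumr_ge0// => j _; exact: powR_ge0.
Qed.

(** The weight is the convex combination [B cos^2 + B0 sin^2]. This secures its positivity even for
    [B < B0]. *)
Lemma angular_weight_ge {R : realType} (B B0 x : R) :
  Num.min B B0 <= (B - B0) * cos x ^+ 2 + B0.
Proof.
have -> : (B - B0) * cos x ^+ 2 + B0 = B * cos x ^+ 2 + B0 * sin x ^+ 2.
  by rewrite sin2cos2; ring.
have := cos2Dsin2 x; have := sqr_ge0 (cos x); have := sqr_ge0 (sin x).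
move: (cos x ^+ 2) (sin x ^+ 2) => c s s0 c0 e.
have h1 : Num.min B B0 <= B by rewrite ge_min lexx.
have h2 : Num.min B B0 <= B0 by rewrite ge_min lexx orbT.
rewrite -[leLHS]mulr1 -e mulrDr; apply: lerD; exact: ler_wpM2r.
Qed.

(** The term [j = 1] has chord ratio 1 and the others are nonnegative. The denominator of the radius
    thus stays away from 0 uniformly in [N]. *)
Lemma attraction_ge {R : realType} (B B0 beta : R) (N : nat) :
  0 < B -> 0 < B0 -> (2 <= N)%N -> Num.min B B0 <= attraction B B0 beta N.
Proof.
move=> B_gt0 B0_gt0 N2; rewrite /attraction big_ltn; last lia.
have m0 : 0 < Num.min B B0 by rewrite lt_min B_gt0.
rewrite chord_ratio1// powR1 mulr1 -[leLHS]addr0 lerD ?angular_weight_ge//.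
apply: sumr_ge0 => j _; rewrite mulr_ge0 ?powR_ge0//.
exact: le_trans (ltW m0) (angular_weight_ge _ _ _).
Qed.

Lemma attraction_zeta {R : realType} (B B0 beta : R) : 1 < beta ->
  exists2 C : R, 0 < C & forall N, (2 <= N)%N ->
    `|attraction B B0 beta N - 2 * B * zeta beta| <= C * rate beta N.
Proof.
move=> b1; have [C1 C10 h1] := ring_sum_zeta _ _ b1 (lexx beta).
have [C2 C20 h2] := ring_sum_sin2 _ b1.
(* The summand [1] only makes the constant positive. *)
exists (`|B| * C1 + `|B - B0| * C2 + 1) => [|N N2].
  by rewrite ltr_wpDl// addr_ge0// mulr_ge0// ltW.
have -> : attraction B B0 beta N - 2 * B * zeta beta =
  B * (\sum_(1 <= j < N) chord_ratio N j `^ beta - 2 * zeta beta) -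
  (B - B0) * \sum_(1 <= j < N) sin (j%:R * pi / N%:R) ^+ 2 * chord_ratio N j `^ beta.
  rewrite mulrBr mulrCA mulrA addrAC; congr (_ - _).
  rewrite !mulr_sumr -sumrB; apply: eq_bigr => j _.
  by rewrite cos2sin2; ring.
apply: (le_trans (ler_normB _ _)); rewrite !normrM.
have -> : (`|B| * C1 + `|B - B0| * C2 + 1) * rate beta N =
  `|B| * (C1 * rate beta N) + `|B - B0| * (C2 * rate beta N) + rate beta N by ring.
have S0 : 0 <= \sum_(1 <= j < N) sin (j%:R * pi / N%:R) ^+ 2 * chord_ratio N j `^ beta :> R.
  by apply: sumr_ge0 => j _; rewrite mulr_ge0 ?powR_ge0// sqr_ge0.
rewrite -[leLHS]addr0 !lerD ?rate_ge0// ?ler_wpM2l ?h1// ger0_norm// h2//.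
Qed.

Lemma Atilde_gt0 {R : realType} (A alpha : R) (N : nat) :
  0 < A -> 0 < alpha -> (2 <= N)%N -> 0 < Atilde A alpha N.
Proof.
move=> A0 a0 N2; rewrite /Atilde big_ltn; last lia.
have s0 : 0 < sin (1%:R * pi / N%:R) :> R by apply: sin_frac_gt0; lia.
rewrite mulr_gt0 ?divr_gt0 ?mulr_gt0 ?powR_gt0// ltr_pwDl ?divr_gt0 ?powR_gt0 ?normr_gt0 ?gt_eqF//.
by apply: sumr_ge0 => j _; rewrite divr_ge0 ?powR_ge0.
Qed.

Lemma Btilde_gt0 {R : realType} (B B0 beta : R) (N : nat) :
  0 < B -> 0 < B0 -> 0 < beta -> (2 <= N)%N -> 0 < Btilde B B0 beta N.
Proof.
move=> B_gt0 B0_gt0 b0 N2; rewrite /Btilde big_ltn; last lia.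
have s0 : 0 < sin (1%:R * pi / N%:R) :> R by apply: sin_frac_gt0; lia.
have w0 x : 0 < (B - B0) * cos x ^+ 2 + B0.
  by apply: lt_le_trans (angular_weight_ge _ _ _); rewrite lt_min B_gt0.
rewrite mulr_gt0 ?divr_gt0 ?powR_gt0// ltr_pwDl ?divr_gt0 ?powR_gt0 ?normr_gt0 ?gt_eqF//.
by apply: sumr_ge0 => j _; rewrite divr_ge0 ?powR_ge0// ltW.
Qed.

(** The left side is the side length of the equilibrium ring. Its factor [2 sin (pi/N)] enters the
    power raised to [alpha - beta]; the numerator takes the part [alpha], the denominator the part
    [beta], and each inverse sine becomes a chord ratio. *)
Lemma rstar_chord {R : realType} (A B B0 alpha beta : R) (N : nat) :
  0 < A -> 0 < B -> 0 < B0 -> 1 < beta -> beta < alpha -> (2 <= N)%N ->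
  2 * rstar A B B0 alpha beta N * sin (pi / N%:R) =
  (alpha * A * (\sum_(1 <= j < N) chord_ratio N j `^ alpha) /
    (beta * attraction B B0 beta N)) `^ (1 / (alpha - beta)).
Proof.
move=> A_gt0 B_gt0 B0_gt0 b1 ab N2; set g := 1 / (alpha - beta).
have ab0 : 0 < alpha - beta by rewrite subr_gt0.
have s0 := @sin_piV_gt0 R N N2; set s := sin (pi / N%:R) in s0 *.
have ss0 : 0 < 2 * s by rewrite mulr_gt0.
have e : 2 * s = ((2 * s) `^ (alpha - beta)) `^ g.
  by rewrite -powRrM /g mul1r divff ?gt_eqF// powRr1// ltW.
rewrite mulrAC e /rstar mulrC -/g.
(* One identity for both sums: [w] is 1 for [Atilde] and the angular weight for [Btilde]. *)
have term (w : nat -> R) (p : R) : 0 < p ->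
    p / 2 `^ (p + 1) * (\sum_(1 <= j < N) w j / `|sin (j%:R * pi / N%:R)| `^ p)
    * (2 * s) `^ p = p / 2 * \sum_(1 <= j < N) w j * chord_ratio N j `^ p.
  move=> p0; rewrite mulr_sumr mulr_suml mulr_sumr !big_nat; apply: eq_bigr => j jN.
  have sj : 0 < sin (j%:R * pi / N%:R) :> R by apply: sin_frac_gt0.
  rewrite gtr0_norm// /chord_ratio -/s.
  have eV : (sin (j%:R * pi / N%:R))^-1 `^ p = (sin (j%:R * pi / N%:R) `^ p)^-1 :> R.
    exact/powR_invr/ltW.
  rewrite !powRM ?(ltW s0) ?invr_ge0 ?(ltW sj)// eV.
  rewrite powRD ?pnatr_eq0 ?implybT// powRr1//.
  have : 2 `^ p != 0 :> R by rewrite gt_eqF// powR_gt0.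
  by move: (2 `^ p) => x x0; field; rewrite x0 gt_eqF// powR_gt0.
have eA : Atilde A alpha N * (2 * s) `^ alpha =
    A * (alpha / 2 * \sum_(1 <= j < N) chord_ratio N j `^ alpha).
  have <- : \sum_(1 <= j < N) 1 * chord_ratio N j `^ alpha =
      \sum_(1 <= j < N) chord_ratio N j `^ alpha :> R.
    by apply: eq_bigr => j _; rewrite mul1r.
  by rewrite -(term (fun=> 1)) /Atilde; [ring|lra].
have eB : Btilde B B0 beta N * (2 * s) `^ beta = beta / 2 * attraction B B0 beta N.
  by rewrite /Btilde term//; lra.
have m0 : 0 < Num.min B B0 by rewrite lt_min B_gt0.
have Q0 := lt_le_trans m0 (@attraction_ge R B B0 beta N B_gt0 B0_gt0 N2).
have sb0 : 0 < (2 * s) `^ beta by rewrite powR_gt0.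
have b0 : 0 < beta by lra.
have Bt0 := @Btilde_gt0 R B B0 beta N B_gt0 B0_gt0 b0 N2.
have At0 : 0 <= Atilde A alpha N by apply/ltW/Atilde_gt0 => //; lra.
rewrite -powRM ?powR_ge0 ?divr_ge0 ?(ltW Bt0)//; congr (_ `^ _).
rewrite powRB; last by rewrite (gt_eqF ss0) implybT.
rewrite [LHS](_ : _ = (Atilde A alpha N * (2 * s) `^ alpha) /
  (Btilde B B0 beta N * (2 * s) `^ beta)); last first.
  by field; rewrite !gt_eqF.
rewrite eA eB; field.
by rewrite !gt_eqF//; lra.
Qed.

(** Applied with [p'], [q'] the limits; only the varying denominator [q] is bounded below by [m]. *)
Lemma div_lipschitz {R : realType} (p p' q q' m : R) : 0 < m -> m <= q -> 0 < q' ->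
  0 <= p' ->
  `|p / q - p' / q'| <= m^-1 * `|p - p'| + p' / (m * q') * `|q - q'|.
Proof.
move=> m0 mq q'0 p'0; have q0 : 0 < q by lra.
have -> : p / q - p' / q' = q^-1 * (p - p') - p' / (q * q') * (q - q').
  by field; rewrite !gt_eqF.
apply: (le_trans (ler_normB _ _)); rewrite !normrM.
have iq : q^-1 <= m^-1 by rewrite lef_pV2.
rewrite !normfV normrM (gtr0_norm q0) (gtr0_norm q'0) (ger0_norm p'0).
rewrite lerD//; apply: ler_wpM2r => //.
by apply: ler_wpM2l => //; rewrite lef_pV2 ?posrE ?mulr_gt0// ler_pM2r.
Qed.

(** The base of the power tends to [p' / q'], where the factors 2 of the two zeta limits cancel. The
    power is Lipschitz on one interval [[m, M]] that contains the quotients for all [N]. *)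
Lemma rstar_chord_rate {R : realType} (A B B0 alpha beta : R) :
  0 < A -> 0 < B -> 0 < B0 -> 1 < beta -> beta < alpha ->
  exists2 C : R, 0 < C & forall N, (2 <= N)%N ->
    `|2 * rstar A B B0 alpha beta N * sin (pi / N%:R) - hbar A B alpha beta|
    <= C * rate beta N.
Proof.
move=> A_gt0 B_gt0 B0_gt0 b1 ab.
have a1 : 1 < alpha by lra.
have za := zeta_ge1 _ a1; have zb := zeta_ge1 _ b1.
have [C1 C10 h1] := ring_sum_zeta _ _ b1 (ltW ab).
have [C2 C20 h2] := @attraction_zeta R B B0 _ b1.
pose mu := beta * Num.min B B0.
have mu0 : 0 < mu by rewrite mulr_gt0// ?lt_min ?B_gt0//; lra.
pose p' := alpha * A * (2 * zeta alpha).
pose q' := beta * (2 * B * zeta beta).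
have aA0 : 0 < alpha * A by rewrite mulr_gt0//; lra.
have p'0 : 0 < p' by rewrite mulr_gt0// mulr_gt0//; lra.
have q'0 : 0 < q' by rewrite !mulr_gt0//; lra.
pose L := mu^-1 * (alpha * A * C1) + p' / (mu * q') * (beta * C2).
have L0 : 0 < L.
  rewrite addr_gt0// mulr_gt0 ?invr_gt0// ?divr_gt0// mulr_gt0//; lra.
pose g := 1 / (alpha - beta).
have g0 : 0 < g by rewrite divr_gt0// subr_gt0.
(* The quotient is within [L * rate <= L] of its limit. *)
pose M := p' / q' + L.
have M1 : p' / q' <= M by rewrite lerDl ltW.
(* For the lower end, the sum in the numerator is at least 1 and the attraction at most its limit
   plus [C2]. *)
pose m := Num.min (p' / q') (alpha * A / (beta * (`|2 * B * zeta beta| + C2))).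
have den0 : 0 < beta * (`|2 * B * zeta beta| + C2) by rewrite mulr_gt0 ?ltr_wpDl//; lra.
have m0 : 0 < m by rewrite lt_min !divr_gt0.
have M0 : 0 < M by rewrite addr_gt0// divr_gt0.
exists (g * M `^ g / m * L) => [|N N2].
  by rewrite mulr_gt0// divr_gt0// mulr_gt0// powR_gt0.
have r0 := @rate_ge0 R beta N N2; have r1 := @rate_le1 R beta N b1 N2.
pose p := alpha * A * \sum_(1 <= j < N) chord_ratio N j `^ alpha.
pose q := beta * attraction B B0 beta N.
have mq : mu <= q by rewrite ler_wpM2l ?attraction_ge//; lra.
have q0 : 0 < q by exact: lt_le_trans mq.
have hd : `|p / q - p' / q'| <= L * rate beta N.
  apply: (le_trans (@div_lipschitz R p p' q q' mu mu0 mq q'0 (ltW p'0))).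
  have -> : L * rate beta N = mu^-1 * (alpha * A * (C1 * rate beta N)) +
      p' / (mu * q') * (beta * (C2 * rate beta N)) by rewrite /L; ring.
  apply: lerD; apply: ler_wpM2l; rewrite ?invr_ge0 ?(ltW mu0)//.
  - rewrite -mulrBr normrM gtr0_norm//; apply: ler_wpM2l; first exact: ltW.
    exact: h1.
  - exact: divr_ge0 (ltW p'0) (mulr_ge0 (ltW mu0) (ltW q'0)).
  rewrite -mulrBr normrM gtr0_norm; last lra.
  by apply: ler_wpM2l; [lra|exact: h2].
have -> : hbar A B alpha beta = (p' / q') `^ g.
  rewrite /hbar; congr (_ `^ _); rewrite /p' /q'; field.
  by rewrite !gt_eqF//; lra.
rewrite rstar_chord// -/g -/p -/q.
have hpq : p / q <= M.
  have := ler_norm (p / q - p' / q'); rewrite /M.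
  have : L * rate beta N <= L by rewrite ler_piMr// ltW.
  lra.
have hqq : m <= p / q.
  rewrite /m ge_min; apply/orP; right.
  apply: ler_pM.
  - exact: ltW.
  - by rewrite invr_ge0 ltW.
  - rewrite -[leLHS]mulr1; apply: ler_wpM2l; first exact: ltW.
    exact: chord_ratio_sum_ge1.
  rewrite lef_pV2 ?posrE//; apply: ler_wpM2l; first lra.
  have hh := h2 N N2; have := ler_norm (attraction B B0 beta N - 2 * B * zeta beta).
  have := ler_norm (2 * B * zeta beta).
  have : C2 * rate beta N <= C2 by rewrite ler_piMr// ltW.
  lra.
rewrite -[leRHS]mulrA; apply: (le_trans (@powR_lipschitz R g m M _ _ (ltW g0) m0 _ _)).
- by rewrite hqq.
- by rewrite M1 andbT /m ge_min lexx.
apply: ler_wpM2l hd; exact: divr_ge0 (mulr_ge0 (ltW g0) (powR_ge0 _ _)) (ltW m0).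
Qed.

(** * Derivative of the energy along a curve *)

Lemma is_derive_mulf {R : realType} (f g : R -> R) (x df dg : R) :
  is_derive x 1 f df -> is_derive x 1 g dg ->
  is_derive x 1 (fun t => f t * g t) (df * g x + f x * dg).
Proof.
move=> hf hg; have h := is_deriveM hf hg.
by apply: (is_derive_eq h); rewrite addrC [df * _]mulrC.
Qed.

Lemma is_derive_addf {R : realType} (f g : R -> R) (x df dg : R) :
  is_derive x 1 f df -> is_derive x 1 g dg ->
  is_derive x 1 (fun t => f t + g t) (df + dg).
Proof. by move=> hf hg; exact: is_deriveD. Qed.

Lemma is_derive_subf {R : realType} (f g : R -> R) (x df dg : R) :
  is_derive x 1 f df -> is_derive x 1 g dg ->
  is_derive x 1 (fun t => f t - g t) (df - dg).
Proof. by move=> hf hg; exact: is_deriveB. Qed.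

Lemma is_derive_scalef {R : realType} (a : R) (f : R -> R) (x df : R) :
  is_derive x 1 f df -> is_derive x 1 (fun t => a * f t) (a * df).
Proof.
move=> hf; have h := is_derive_mulf _ _ _ _ _ (is_derive_cst a x 1) hf.
by apply: (is_derive_eq h); rewrite mul0r add0r.
Qed.

Lemma is_derive_bigsum {R : realType} (I : Type) (r : seq I) (P : pred I)
    (h : I -> R -> R) (dh : I -> R) (x : R) :
  (forall i, P i -> is_derive x 1 (h i) (dh i)) ->
  is_derive x 1 (fun t => \sum_(i <- r | P i) h i t) (\sum_(i <- r | P i) dh i).
Proof.
move=> hd; elim: r => [|i r IH].
  rewrite big_nil (_ : (fun _ => _) = cst 0); first exact: is_derive_cst.
  by apply/funext => t; rewrite big_nil.
rewrite big_cons; under eq_fun do rewrite big_cons.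
by case: ifPn => // Pi; apply: is_derive_addf => //; exact: hd.
Qed.

Lemma is_derive_dot {R : realType} (u v : R -> 'rV[R]_3) (du dv : 'rV[R]_3) (x : R) :
  (forall i, is_derive x 1 (fun t => u t 0 i) (du 0 i)) ->
  (forall i, is_derive x 1 (fun t => v t 0 i) (dv 0 i)) ->
  is_derive x 1 (fun t => dot (u t) (v t)) (dot du (v x) + dot (u x) dv).
Proof.
move=> hu hv; rewrite /dot -big_split/=; apply: is_derive_bigsum => i _.
exact: is_derive_mulf.
Qed.

(** The derivative is written as a multiple of the inverse power itself, so that later identities
    can treat that power as an atom. *)
Lemma is_derive_enorm_powV {R : realType} (u : R -> 'rV[R]_3) (du : 'rV[R]_3)
    (x b : R) :
  (forall i, is_derive x 1 (fun t => u t 0 i) (du 0 i)) ->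
  0 < dot (u x) (u x) ->
  is_derive x 1 (fun t => (enorm (u t) `^ b)^-1)
    (- b * (dot (u x) du / dot (u x) (u x)) * (enorm (u x) `^ b)^-1).
Proof.
move=> hu q0; have hq := is_derive_dot _ _ _ _ _ hu hu.
have d0 : 0 < enorm (u x) by rewrite sqrtr_gt0.
have h1 : is_derive x 1 (fun t => enorm (u t))
    ((2 * enorm (u x))^-1 * (dot du (u x) + dot (u x) du)).
  exact: (is_derive1_comp (is_derive1_sqrt q0) hq).
have h2 := @is_derive1_comp R (fun y : R => y `^ (- b)) (fun t => enorm (u t)) x _ _
  (is_derive1_powR (- b) d0) h1.
rewrite (_ : (fun t => _) = (fun y : R => y `^ (- b)) \o (fun t => enorm (u t))); last first.
  by apply/funext => t /=; rewrite powRN.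
apply: (is_derive_eq h2).
rewrite powRB; last by rewrite (gt_eqF d0) implybT.
have dC : dot du (u x) = dot (u x) du by apply: eq_bigr => i _; rewrite mulrC.
have eq : dot (u x) (u x) = enorm (u x) ^+ 2 by rewrite sqr_sqrtr// ltW.
rewrite powRr1 ?(ltW d0)// powRN dC eq.
by move: (enorm (u x) `^ b)^-1 => w; field; rewrite gt_eqF.
Qed.

Lemma continuous_pos_coord {R : realType} (N : nat) (k : 'I_N) (i : 'I_3) :
  continuous (fun p : config R N => p.1 k i : R).
Proof.
move=> p; apply: (@continuous_comp _ _ _ fst (fun M : 'M[R]_(N, 3) => M k i : R)).
  exact: cvg_fst.
exact: coord_continuous.
Qed.

Lemma continuous_moment_coord {R : realType} (N : nat) (k : 'I_N) (i : 'I_3) :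
  continuous (fun p : config R N => p.2 k i : R).
Proof.
move=> p; apply: (@continuous_comp _ _ _ snd (fun M : 'M[R]_(N, 3) => M k i : R)).
  exact: cvg_snd.
exact: coord_continuous.
Qed.

Lemma derivable_pos_coord {R : realType} (N : nat) (c : R -> config R N) (x : R)
    (k : 'I_N) (i : 'I_3) : derivable c x 1 -> derivable (fun t => (c t).1 k i) x 1.
Proof.
move=> /cvg_ex[l hl]; apply/cvg_ex; exists (l.1 k i).
apply: cvg_trans (continuous_cvg _ (continuous_pos_coord N k i l) hl).
by apply: near_eq_cvg; apply: nearW => t /=; rewrite !mxE.
Qed.

Lemma derivable_moment_coord {R : realType} (N : nat) (c : R -> config R N) (x : R)
    (k : 'I_N) (i : 'I_3) : derivable c x 1 -> derivable (fun t => (c t).2 k i) x 1.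
Proof.
move=> /cvg_ex[l hl]; apply/cvg_ex; exists (l.2 k i).
apply: cvg_trans (continuous_cvg _ (continuous_moment_coord N k i l) hl).
by apply: near_eq_cvg; apply: nearW => t /=; rewrite !mxE.
Qed.

(** * Euclidean products and the pair terms *)

Lemma dotC {R : realType} (u v : 'rV[R]_3) : dot u v = dot v u.
Proof. by apply: eq_bigr => i _; rewrite mulrC. Qed.

Lemma dotDl {R : realType} (u v w : 'rV[R]_3) : dot (u + v) w = dot u w + dot v w.
Proof. by rewrite /dot -big_split; apply: eq_bigr => i _; rewrite mxE mulrDl. Qed.

Lemma dotZl {R : realType} (a : R) (u v : 'rV[R]_3) : dot (a *: u) v = a * dot u v.
Proof. by rewrite /dot mulr_sumr; apply: eq_bigr => i _; rewrite mxE mulrA. Qed.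

Lemma dotNl {R : realType} (u v : 'rV[R]_3) : dot (- u) v = - dot u v.
Proof. by rewrite -scaleN1r dotZl mulN1r. Qed.

Lemma dotDr {R : realType} (u v w : 'rV[R]_3) : dot w (u + v) = dot w u + dot w v.
Proof. by rewrite dotC dotDl !(dotC w). Qed.

Lemma dotZr {R : realType} (a : R) (u v : 'rV[R]_3) : dot v (a *: u) = a * dot v u.
Proof. by rewrite dotC dotZl dotC. Qed.

Lemma dotNr {R : realType} (u v : 'rV[R]_3) : dot v (- u) = - dot v u.
Proof. by rewrite dotC dotNl dotC. Qed.

Lemma dot_vec3 {R : realType} (a b c : R) (v : 'rV[R]_3) :
  dot (vec3 a b c) v = a * v 0 0 + b * v 0 1 + c * v 0 2.
Proof.
rewrite /dot !big_ord_recl big_ord0 !mxE/= addr0 addrA.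
by congr (_ * v 0 _ + _ * v 0 _ + _ * v 0 _); exact/val_inj.
Qed.

Lemma enormN {R : realType} (u : 'rV[R]_3) : enorm (- u) = enorm u.
Proof. by rewrite /enorm dotNl dotNr opprK. Qed.

(* The part of the derivative of the pair term due to the displacement [v] and
   rotation [w] of the first particle alone; the pair term differentiates to
   the sum of this expression and the one with the particles exchanged. *)
Definition half_force {R : realType} (A B B0 alpha beta : R)
    (m m' rho v w : 'rV[R]_3) : R :=
  B0 * dot w m' * (enorm rho `^ beta)^-1
  - (B + B0) * ((dot w rho + dot m v) * dot m' rho + dot m rho * dot m' v)
    * (enorm rho `^ (beta + 2))^-1
  + (- beta * B0 * dot m m' * (enorm rho `^ beta)^-1
     + (beta + 2) * (B + B0) * (dot m rho * dot m' rho)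
       * (enorm rho `^ (beta + 2))^-1
     - alpha * A * (enorm rho `^ alpha)^-1) * (dot rho v / dot rho rho).

(** Exchanging the names in the second summand gives all ordered pairs, so that each particle
    collects the whole force on it. *)
Lemma sum_pairs {V : nmodType} (N : nat) (F : 'I_N -> 'I_N -> V) :
  \sum_(k < N) \sum_(l < N | (l < k)%N) (F k l + F l k) =
  \sum_(k < N) \sum_(l < N | l != k) F k l.
Proof.
under eq_bigr do rewrite big_split.
rewrite big_split/= [X in _ + X](exchange_big_dep predT)//= -big_split/=.
apply: eq_bigr => k _; rewrite [RHS](bigID (fun l : 'I_N => (l < k)%N))/=.
congr (_ + _); apply: eq_bigl => l; rewrite -(inj_eq val_inj)/=; lia.
Qed.

Lemma is_derive_pair_energy {R : realType} (A B B0 alpha beta : R)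
    (m m' x x' : R -> 'rV[R]_3) (dm dm' dx dx' : 'rV[R]_3) :
  (forall i, is_derive (0 : R) 1 (fun t => m t 0 i) (dm 0 i)) ->
  (forall i, is_derive (0 : R) 1 (fun t => m' t 0 i) (dm' 0 i)) ->
  (forall i, is_derive (0 : R) 1 (fun t => x t 0 i) (dx 0 i)) ->
  (forall i, is_derive (0 : R) 1 (fun t => x' t 0 i) (dx' 0 i)) ->
  0 < dot (x 0 - x' 0) (x 0 - x' 0) ->
  is_derive (0 : R) 1 (fun t =>
    let r := x t - x' t in
    B0 * (dot (m t) (m' t) / enorm r `^ beta)
    - (B + B0) * (dot (m t) r * dot (m' t) r / enorm r `^ (beta + 2))
    + A / enorm r `^ alpha)
   (half_force A B B0 alpha beta (m 0) (m' 0) (x 0 - x' 0) dx dm +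
    half_force A B B0 alpha beta (m' 0) (m 0) (x' 0 - x 0) dx' dm').
Proof.
move=> hm hm' hx hx' q0.
have hr i : is_derive (0 : R) 1 (fun t => (x t - x' t) 0 i) ((dx - dx') 0 i).
  under eq_fun do rewrite !mxE; rewrite !mxE; exact: is_derive_subf.
have D1 := is_derive_dot _ _ _ _ _ hm hm'.
have D2 := is_derive_dot _ _ _ _ _ hm hr.
have D3 := is_derive_dot _ _ _ _ _ hm' hr.
have W b := @is_derive_enorm_powV R _ _ _ b hr q0.
have D := is_derive_addf _ _ _ _ _
  (is_derive_subf _ _ _ _ _
    (is_derive_scalef B0 _ _ _ (is_derive_mulf _ _ _ _ _ D1 (W beta)))
    (is_derive_scalef (B + B0) _ _ _
      (is_derive_mulf _ _ _ _ _ (is_derive_mulf _ _ _ _ _ D2 D3) (W (beta + 2)))))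
  (is_derive_scalef A _ _ _ (W alpha)).
apply: (is_derive_eq D).
(* Exchanging the particles reverses [rho]: norms are unchanged and the signs come out of the
   products. *)
rewrite /half_force -(opprB (x 0) (x' 0)) enormN (dotC dm' (m 0)) (dotC (m' 0) (m 0)).
move: (x 0 - x' 0) q0 => rho q0; rewrite !(dotNl, dotNr, dotDr) !opprK.
move: (enorm _ `^ beta)^-1 (enorm _ `^ (beta + 2))^-1 (enorm _ `^ alpha)^-1 => w1 w2 w3.
by field; rewrite gt_eqF.
Qed.

(** * The force on a ring *)

Lemma dot_gt0 {R : realType} (u : 'rV[R]_3) : u != 0 -> 0 < dot u u.
Proof.
move=> u0; have du0 : 0 <= dot u u by apply: sumr_ge0 => i _; rewrite -expr2 sqr_ge0.
rewrite lt_neqAle du0 andbT eq_sym; apply: contraNneq u0 => h.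
apply/eqP/rowP => i; rewrite mxE; apply/eqP; rewrite -sqrf_eq0 expr2; apply/eqP.
by move: i isT; apply/psumr_eq0P => // i _; rewrite -expr2 sqr_ge0.
Qed.

Lemma is_derive_energy {R : realType} (A B B0 alpha beta : R) (N : nat)
    (c : R -> config R N) (v w : 'I_N -> 'rV[R]_3) :
  (forall k i, is_derive (0 : R) 1 (fun t => (c t).1 k i) (v k 0 i)) ->
  (forall k i, is_derive (0 : R) 1 (fun t => (c t).2 k i) (w k 0 i)) ->
  injective (pos (c 0)) ->
  is_derive (0 : R) 1 (energy A B B0 alpha beta (N:=N) \o c)
    (\sum_(k < N) \sum_(l < N | l != k)
      half_force A B B0 alpha beta (moment (c 0) k) (moment (c 0) l)
        (pos (c 0) k - pos (c 0) l) (v k) (w k)).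
Proof.
move=> hv hw inj; rewrite -sum_pairs.
have hp k i : is_derive (0 : R) 1 (fun t => pos (c t) k 0 i) (v k 0 i).
  by under eq_fun do rewrite mxE; exact: hv.
have hm k i : is_derive (0 : R) 1 (fun t => moment (c t) k 0 i) (w k 0 i).
  by under eq_fun do rewrite mxE; exact: hw.
apply: is_derive_bigsum => k _; apply: is_derive_bigsum => l lk.
apply: is_derive_pair_energy => //.
by apply: dot_gt0; rewrite subr_eq0 (inj_eq inj) -(inj_eq val_inj)/= gtn_eqF.
Qed.

Definition radial {R : realType} (x : R) : 'rV[R]_3 := vec3 (cos x) (sin x) 0.

Definition tangential {R : realType} (x : R) : 'rV[R]_3 := vec3 (- sin x) (cos x) 0.

Definition ring_angle {R : realType} (N k : nat) : R := 2 * pi * k%:R / N%:R.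

Lemma pos_ring {R : realType} (N : nat) (r : R) (k : 'I_N) :
  pos (ring_config N r) k = r *: radial (ring_angle N k).
Proof. exact: rowK. Qed.

Lemma moment_ring {R : realType} (N : nat) (r : R) (k : 'I_N) :
  moment (ring_config N r) k = tangential (ring_angle N k).
Proof. exact: rowK. Qed.

Lemma dot_radial {R : realType} (x : R) : dot (radial x) (radial x) = 1.
Proof. by rewrite dot_vec3 !mxE/= mul0r addr0 -!expr2 cos2Dsin2. Qed.

Lemma dot_tangential {R : realType} (x : R) : dot (tangential x) (tangential x) = 1.
Proof. by rewrite dot_vec3 !mxE/= mul0r addr0 mulrNN -!expr2 addrC cos2Dsin2. Qed.

Lemma dot_radial_tangential {R : realType} (x : R) :
  dot (radial x) (tangential x) = 0.
Proof. by rewrite dot_vec3 !mxE/=; ring. Qed.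

(** The chord in the orthonormal frame of the particle at angle [x]; [2 r sin y] is its signed
    length. *)
Lemma radial_diff {R : realType} (x y r : R) :
  r *: radial x - r *: radial (x - y *+ 2) =
  (2 * r * sin y) *: (sin y *: radial x + cos y *: tangential x).
Proof.
apply/rowP => i; rewrite !mxE cosB sinB cos_mulr2n sin_mulr2n.
case: i => [[|[|[|//]]] hi] /=; last by ring.
  by rewrite cos2sin2; ring.
by rewrite cos2sin2; ring.
Qed.

Lemma tangential_shift {R : realType} (x y : R) :
  tangential (x - y *+ 2) =
  (2 * cos y ^+ 2 - 1) *: tangential x + (2 * sin y * cos y) *: radial x.
Proof.
apply/rowP => i; rewrite !mxE cosB sinB cos_mulr2n sin_mulr2n.
by case: i => [[|[|[|//]]] hi] /=; ring.
Qed.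

Lemma enorm_radial_diff {R : realType} (x y r : R) : 0 < r ->
  enorm (r *: radial x - r *: radial (x - y *+ 2)) = 2 * r * `|sin y|.
Proof.
move=> r0; rewrite radial_diff /enorm dotZl dotZr !(dotDl, dotDr, dotZl, dotZr).
rewrite [dot (tangential x) (radial x)]dotC dot_radial dot_tangential dot_radial_tangential.
have -> : 2 * r * sin y * (2 * r * sin y * (sin y * (sin y * 1 + cos y * 0) +
    cos y * (sin y * 0 + cos y * 1))) =
    (2 * r * sin y) ^+ 2 * (cos y ^+ 2 + sin y ^+ 2) by ring.
by rewrite cos2Dsin2 mulr1 sqrtr_sqr normrM gtr0_norm// mulr_gt0.
Qed.

(* The coefficient of [dot (radial x) v] in [half_force] between ring particles
   at half-angle [y], and below, up to the odd factor [cos y / sin y], the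
   contribution of the tangential displacement [vm] and the rotation [we]. *)
Definition radial_force {R : realType} (A B B0 alpha beta r y : R) : R :=
  (2 * r)^-1 *
  (beta * ((B - B0) * cos y ^+ 2 + B0) * ((2 * r * `|sin y|) `^ beta)^-1
   - alpha * A * ((2 * r * `|sin y|) `^ alpha)^-1).

Definition odd_force {R : realType} (A B B0 alpha beta r vm we y : R) : R :=
  (2 * B0 * sin y ^+ 2 * we
   - (B + B0) / (2 * r) * (2 * r * sin y ^+ 2 * we + 2 * cos y ^+ 2 * vm)
   + (- beta * B0 * (2 * cos y ^+ 2 - 1) + (beta + 2) * (B + B0) * cos y ^+ 2)
     * vm / (2 * r)) * ((2 * r * `|sin y|) `^ beta)^-1
  - alpha * A * vm / (2 * r) * ((2 * r * `|sin y|) `^ alpha)^-1.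

(** The chord and both moments lie in the plane of the ring, so only planar components of [v] and
    [w] enter. Orthogonality to the moment leaves of [w] only the radial one. *)
Lemma half_force_ring {R : realType} (A B B0 alpha beta r x y : R) (v w : 'rV[R]_3) :
  0 < r -> sin y != 0 -> dot (tangential x) w = 0 ->
  half_force A B B0 alpha beta (tangential x) (tangential (x - y *+ 2))
    (r *: radial x - r *: radial (x - y *+ 2)) v w =
  dot (radial x) v * radial_force A B B0 alpha beta r y +
  cos y / sin y *
    odd_force A B B0 alpha beta r (dot (tangential x) v) (dot (radial x) w) y.
Proof.
move=> r0 s0 wm; rewrite /half_force enorm_radial_diff// radial_diff tangential_shift.
have d0 : 0 < 2 * r * `|sin y| by rewrite !mulr_gt0// normr_gt0.
(* Splitting off the square turns [|sin y|^2] into [sin^2 y], and only the powers [beta] and [alpha]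
   remain. *)
rewrite (@powRD R _ beta 2); last by rewrite (gt_eqF d0) implybT.
rewrite powR_mulrn ?(ltW d0)// [(2 * r * `|sin y|) ^+ 2]exprMn real_normK ?num_real//.
set rho := _ *: (_ + _).
set m' := (2 * cos y ^+ 2 - 1) *: tangential x + (2 * sin y * cos y) *: radial x.
have e1 : dot w m' = 2 * sin y * cos y * dot (radial x) w.
  by rewrite dotC dotDl !dotZl wm; ring.
have e2 : dot w rho = 2 * r * sin y * (sin y * dot (radial x) w).
  by rewrite dotC dotZl dotDl !dotZl wm; ring.
have e3 : dot m' rho = 2 * r * sin y * cos y.
  rewrite dotZr !(dotDl, dotDr, dotZl, dotZr) [dot (tangential x) (radial x)]dotC.
  rewrite dot_radial dot_tangential dot_radial_tangential; have := cos2sin2 y.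
  set s := sin y; set c := cos y => h.
  have -> : 2 * r * s * ((2 * c ^+ 2 - 1) * (s * 0 + c * 1) + 2 * s * c * (s * 1 + c * 0)) =
    2 * r * s * c * (2 * (c ^+ 2 - (1 - s ^+ 2)) + 1) by ring.
  by rewrite h subrr mulr0 add0r mulr1.
have e4 : dot (tangential x) rho = 2 * r * sin y * cos y.
  rewrite dotZr dotDr !dotZr [dot (tangential x) (radial x)]dotC.
  by rewrite dot_tangential dot_radial_tangential; ring.
have e5 : dot m' v = (2 * cos y ^+ 2 - 1) * dot (tangential x) v +
    2 * sin y * cos y * dot (radial x) v by rewrite dotDl !dotZl.
have e6 : dot (tangential x) m' = 2 * cos y ^+ 2 - 1.
  rewrite dotDr !dotZr [dot (tangential x) (radial x)]dotC.
  by rewrite dot_tangential dot_radial_tangential; ring.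
have e7 : dot rho v = 2 * r * sin y * (sin y * dot (radial x) v + cos y * dot (tangential x) v).
  by rewrite dotZl dotDl !dotZl.
have e8 : dot rho rho = (2 * r * sin y) ^+ 2.
  rewrite dotZl dotZr !(dotDl, dotDr, dotZl, dotZr) [dot (tangential x) (radial x)]dotC.
  rewrite dot_radial dot_tangential dot_radial_tangential.
  have -> : (2 * r * sin y) ^+ 2 = (2 * r * sin y) ^+ 2 * (cos y ^+ 2 + sin y ^+ 2) :> R.
    by rewrite cos2Dsin2 mulr1.
  by ring.
rewrite e1 e2 e3 e4 e5 e6 e7 e8 /radial_force /odd_force.
have b0 : (2 * r * `|sin y|) `^ beta != 0 by rewrite gt_eqF// powR_gt0.
have a0 : (2 * r * `|sin y|) `^ alpha != 0 by rewrite gt_eqF// powR_gt0.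
by field; rewrite a0 b0 s0 gt_eqF.
Qed.

(** Substitute [j = k - l] modulo [N]; periodicity absorbs the wrap-around. *)
Lemma sum_cyclic_periodic {R : realType} {V : nmodType} (f : R -> V) (N : nat) (k : 'I_N) :
  (forall x, f (x + pi) = f x) ->
  \sum_(l < N | l != k) f ((k%:R - l%:R) * pi / N%:R) =
  \sum_(1 <= j < N) f (j%:R * pi / N%:R).
Proof.
move=> fpi; have N0 : (0 < N)%N by exact: leq_ltn_trans (ltn_ord k).
pose F (l : nat) := f ((k%:R - l%:R) * pi / N%:R).
rewrite (eq_bigl (fun l : 'I_N => (l : nat) != k)); last by move=> l; rewrite -(inj_eq val_inj).
rewrite -(big_mkord (fun l => l != k) F) (@big_cat_nat _ _ _ k)//=; last exact/ltnW.
rewrite [X in _ + X]big_ltn_cond// eqxx/=.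
rewrite [in RHS](@big_cat_nat _ _ _ k.+1)//=; congr (_ + _).
  rewrite big_nat_rev big_add1/= [LHS]big_nat_cond [RHS]big_nat_cond.
  apply: eq_big => [i|i /andP[ik _]]; first by lia.
  rewrite /F; congr (f (_ * _ / _)); rewrite -natrB; last lia.
  by congr (_%:R); lia.
(* For [l > k] the angle is negative; adding [pi] brings it to the index [j = N + k - l]. *)
rewrite big_nat_rev [LHS]big_nat_cond [RHS]big_nat_cond.
apply: eq_big => [i|i /andP[ik _]]; first by lia.
rewrite /F -fpi; congr f; rewrite natrB; last lia.
by rewrite natrD -addn1 !natrD; field; rewrite pnatr_eq0; lia.
Qed.

Lemma sum_antisymmetric {R : realType} (f : nat -> R) (N : nat) :
  (forall j, (0 < j < N)%N -> f (N - j)%N = - f j) -> \sum_(1 <= j < N) f j = 0.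
Proof.
move=> fN; set S := \sum_(1 <= j < N) f j.
have : S = - S.
  rewrite {1}/S big_nat_rev /S -sumrN [LHS]big_nat [RHS]big_nat; apply: eq_bigr => j jN.
  by rewrite -fN//; congr f; lia.
lra.
Qed.

Lemma sin_diff_neq0 {R : realType} (N : nat) (k l : 'I_N) : l != k ->
  sin ((k%:R - l%:R) * pi / N%:R) != 0 :> R.
Proof.
rewrite -(inj_eq val_inj) neq_ltn => /orP[] /= lk; last first.
  have e : (k%:R - l%:R) * pi / N%:R = - ((l - k)%N%:R * pi / N%:R) :> R.
    by rewrite natrB ?(ltnW lk)//; ring.
  rewrite e sinN oppr_eq0 gt_eqF// sin_frac_gt0//.
  by have := ltn_ord l; lia.
rewrite -natrB ?(ltnW lk)// gt_eqF// sin_frac_gt0//.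
by have := ltn_ord k; lia.
Qed.

Lemma ring_angleB {R : realType} (N : nat) (k l : 'I_N) :
  ring_angle N l = ring_angle N k - ((k%:R - l%:R) * pi / N%:R) *+ 2 :> R.
Proof.
have N0 : (0 < N)%N by exact: leq_ltn_trans (ltn_ord k).
by rewrite /ring_angle; field; rewrite pnatr_eq0; lia.
Qed.

Lemma ring_pos_dist {R : realType} (N : nat) (r : R) (k l : 'I_N) : 0 < r ->
  enorm (pos (ring_config N r) k - pos (ring_config N r) l) =
  2 * r * `|sin ((k%:R - l%:R) * pi / N%:R)|.
Proof. by move=> r0; rewrite !pos_ring (ring_angleB N k l) enorm_radial_diff. Qed.

Lemma ring_pos_inj {R : realType} (N : nat) (r : R) : 0 < r ->
  injective (pos (ring_config N r)).
Proof.
move=> r0 l k e; apply/eqP/negP => /negP lk.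
have := ring_pos_dist _ _ k l r0; rewrite e subrr /enorm.
rewrite /dot big1 ?sqrtr0 => [/esym/eqP|i _]; last by rewrite mxE mul0r.
by rewrite mulf_eq0 normr_eq0 (negbTE (sin_diff_neq0 _ _ _ lk)) orbF gt_eqF// mulr_gt0.
Qed.

Lemma ring_in_config_space {R : realType} (N : nat) (r : R) : 0 < r ->
  config_space (ring_config N r).
Proof.
move=> r0; split; first exact: ring_pos_inj.
by move=> k; rewrite moment_ring /enorm dot_tangential sqrtr1.
Qed.

Definition ring_force {R : realType} (A B B0 alpha beta : R) (N : nat) (r : R) : R :=
  \sum_(1 <= j < N) radial_force A B B0 alpha beta r (j%:R * pi / N%:R).

Lemma sum_half_force_ring {R : realType} (A B B0 alpha beta r : R) (N : nat)
    (k : 'I_N) (v w : 'rV[R]_3) :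
  0 < r -> dot (moment (ring_config N r) k) w = 0 ->
  \sum_(l < N | l != k)
    half_force A B B0 alpha beta (moment (ring_config N r) k)
      (moment (ring_config N r) l)
      (pos (ring_config N r) k - pos (ring_config N r) l) v w =
  dot (radial (ring_angle N k)) v * ring_force A B B0 alpha beta N r.
Proof.
rewrite moment_ring => r0 wm.
set x := ring_angle N k in wm *.
pose f y := dot (radial x) v * radial_force A B B0 alpha beta r y.
pose h y := cos y / sin y *
  odd_force A B B0 alpha beta r (dot (tangential x) v) (dot (radial x) w) y.
rewrite (eq_bigr (fun l : 'I_N => f ((k%:R - l%:R) * pi / N%:R) +
    h ((k%:R - l%:R) * pi / N%:R))); last first.
  move=> l lk; rewrite !pos_ring !moment_ring (ring_angleB N k l) -/x.
  by rewrite half_force_ring// sin_diff_neq0.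
(* Under [y -> y + pi] both [sin] and [cos] change sign, but only squares, absolute values and their
   quotient occur. *)
rewrite (@sum_cyclic_periodic R R (fun y => f y + h y)); last first.
  move=> y; rewrite /f /h /radial_force /odd_force sinDpi cosDpi normrN !sqrrN.
  by rewrite invrN mulrNN.
(* Under [y -> pi - y] the factor [cos y / sin y] of [h] alone changes sign, so this part
   cancels. *)
rewrite big_split/= -mulr_sumr -/(ring_force _ _ _ _ _ _ _) [X in _ + X]sum_antisymmetric ?addr0//.
move=> j jN; have -> : (N - j)%N%:R * pi / N%:R = - (j%:R * pi / N%:R) + pi :> R.
  by rewrite natrB; [field; rewrite pnatr_eq0; lia|lia].
rewrite /h /odd_force sinDpi cosDpi sinN cosN opprK !sqrrN.
by rewrite !mulNr.
Qed.

Lemma is_derive_ring_energy {R : realType} (A B B0 alpha beta r : R) (N : nat)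
    (c : R -> config R N) (v w : 'I_N -> 'rV[R]_3) :
  0 < r -> c 0 = ring_config N r -> (\forall t \near (0 : R), config_space (c t)) ->
  (forall k i, is_derive (0 : R) 1 (fun t => (c t).1 k i) (v k 0 i)) ->
  (forall k i, is_derive (0 : R) 1 (fun t => (c t).2 k i) (w k 0 i)) ->
  is_derive (0 : R) 1 (energy A B B0 alpha beta (N:=N) \o c)
    ((\sum_(k < N) dot (radial (ring_angle N k)) (v k)) *
     ring_force A B B0 alpha beta N r).
Proof.
move=> r0 c0 cS hv hw.
have inj : injective (pos (c 0)) by rewrite c0; exact: ring_pos_inj.
have hm k i : is_derive (0 : R) 1 (fun t => moment (c t) k 0 i) (w k 0 i).
  by under eq_fun do rewrite mxE; exact: hw.
(* The squared length of each moment is constant near 0, so its derivative, twice this product,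
   vanishes. *)
have wm k : dot (moment (ring_config N r) k) (w k) = 0.
  have [_ e] := is_derive_dot _ _ _ _ _ (hm k) (hm k).
  have n1 : \forall t \near (0 : R), dot (moment (c t) k) (moment (c t) k) = cst 1 t.
    apply: filterS cS => t [_ /(_ k)]; rewrite /enorm => h.
    have d0 : 0 <= dot (moment (c t) k) (moment (c t) k).
      by apply: sumr_ge0 => i _; rewrite -expr2 sqr_ge0.
    by rewrite -[LHS]sqr_sqrtr// h expr1n.
  move: e; rewrite (near_eq_derive _ n1) derive_cst c0 [dot (w k) _]dotC; lra.
have := is_derive_energy A B B0 alpha beta _ _ _ _ hv hw inj.
rewrite c0 => h; apply: (is_derive_eq h); rewrite mulr_suml.
by apply: eq_bigr => k _; apply: sum_half_force_ring.
Qed.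

(** The prefactors [1 / 2^(p+1)] of [Atilde] and [Btilde] collect the powers of 2 from [(2 r)^(-1)]
    and from the chord length [2 r |sin y|]. *)
Lemma ring_forceE {R : realType} (A B B0 alpha beta r : R) (N : nat) : 0 < r ->
  ring_force A B B0 alpha beta N r =
  r^-1 * (Btilde B B0 beta N / r `^ beta - Atilde A alpha N / r `^ alpha).
Proof.
move=> r0.
have term (w : nat -> R) (p : R) :
    p / 2 `^ (p + 1) * (\sum_(1 <= j < N) w j / `|sin (j%:R * pi / N%:R)| `^ p) / r `^ p
    = 2^-1 * \sum_(1 <= j < N) p * w j * ((2 * r * `|sin (j%:R * pi / N%:R)|) `^ p)^-1.
  rewrite mulr_sumr mulr_suml mulr_sumr; apply: eq_bigr => j _.
  rewrite !powRM ?mulr_ge0 ?(ltW r0)// !invfM powRD ?pnatr_eq0 ?implybT// powRr1// invfM.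
  by ring.
rewrite /Btilde term /Atilde.
have -> : alpha * A / 2 `^ (alpha + 1) *
    (\sum_(1 <= j < N) 1 / `|sin (j%:R * pi / N%:R)| `^ alpha) / r `^ alpha =
    2^-1 * \sum_(1 <= j < N) alpha * A * ((2 * r * `|sin (j%:R * pi / N%:R)|) `^ alpha)^-1.
  rewrite -(term (fun=> A)).
  have -> : \sum_(1 <= j < N) A / `|sin (j%:R * pi / N%:R)| `^ alpha =
      A * \sum_(1 <= j < N) 1 / `|sin (j%:R * pi / N%:R)| `^ alpha.
    by rewrite mulr_sumr; apply: eq_bigr => j _; rewrite mulrA mulr1.
  by ring.
rewrite -mulrBr mulrA -invfM [r * 2]mulrC -sumrB mulr_sumr.
by apply: eq_bigr => j _.
Qed.

(** Dividing out [r^(-1) r^(-beta)] leaves [Btilde = Atilde / r^(alpha - beta)], solved by inverting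
    a nonzero power on positive reals. *)
Lemma ring_force_eq0 {R : realType} (A B B0 alpha beta r : R) (N : nat) :
  0 < A -> 0 < B -> 0 < B0 -> 1 < beta -> beta < alpha -> (2 <= N)%N -> 0 < r ->
  (ring_force A B B0 alpha beta N r == 0) = (r == rstar A B B0 alpha beta N).
Proof.
move=> A_gt0 B_gt0 B0_gt0 b1 ab N2 r0.
have a0 : 0 < alpha by lra.
have b0 : 0 < beta by lra.
have At0 := @Atilde_gt0 R A alpha N A_gt0 a0 N2.
have Bt0 := @Btilde_gt0 R B B0 beta N B_gt0 B0_gt0 b0 N2.
have ab0 : 0 < alpha - beta by rewrite subr_gt0.
have rb0 : 0 < r `^ beta by rewrite powR_gt0.
have ra0 : 0 < r `^ (alpha - beta) by rewrite powR_gt0.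
rewrite ring_forceE// mulf_eq0 invr_eq0 (gt_eqF r0)/=.
have -> : r `^ alpha = r `^ (alpha - beta) * r `^ beta.
  by rewrite -powRD ?(gt_eqF r0) ?implybT// subrK.
rewrite invfM mulrA -mulrBl mulf_eq0 invr_eq0 (gt_eqF rb0) orbF subr_eq0.
apply/eqP/eqP => [e|->].
  rewrite /rstar e invf_div mulrCA divff ?gt_eqF// mulr1.
  by rewrite -powRrM mul1r divff ?gt_eqF// powRr1// ltW.
rewrite /rstar -powRrM mul1r mulVf ?gt_eqF// powRr1 ?divr_ge0 ?(ltW At0) ?(ltW Bt0)//.
by rewrite invf_div mulrCA divff ?gt_eqF// mulr1.
Qed.

(** * Criticality and the vanishing of the force *)

Lemma derivable_line {R : realType} {V : normedModType R} (p d : V) :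
  derivable (fun t : R => p + t *: d) 0 1.
Proof.
apply/cvg_ex; exists d.
apply: (@cvg_trans _ (cst d @ (0 : R)^')); last exact: cvg_cst.
apply: near_eq_cvg; near=> h; have h0 : h != 0 by near: h; exact: nbhs_dnbhs_neq.
rewrite /= scale0r !addr0 addrAC subrr add0r [h *: 1]mulr1.
by rewrite scalerA mulVf// scale1r.
Unshelve. all: by end_near. Qed.

(** Along every admissible curve the derivative is a multiple of [ring_force], so its vanishing
    suffices. Conversely one test curve is enough: the dilating ring, with derivative [N] times the
    force. *)
Lemma critical_ring {R : realType} (A B B0 alpha beta r : R) (N : nat) :
  (0 < N)%N -> 0 < r ->
  critical_point_on (@config_space R N) (@energy R A B B0 alpha beta N)
    (ring_config N r) <-> ring_force A B B0 alpha beta N r = 0.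
Proof.
move=> N0 r0; split=> [[_ crit]|G0]; last first.
  split; first exact: ring_in_config_space.
  move=> c c0 cS dc.
  have hv k i : is_derive (0 : R) 1 (fun t => (c t).1 k i)
      ((\row_i0 'D_1 (fun t => (c t).1 k i0) 0) 0 i).
    by rewrite mxE; apply/derivableP/derivable_pos_coord.
  have hw k i : is_derive (0 : R) 1 (fun t => (c t).2 k i)
      ((\row_i0 'D_1 (fun t => (c t).2 k i0) 0) 0 i).
    by rewrite mxE; apply/derivableP/derivable_moment_coord.
  have h := is_derive_ring_energy A B B0 alpha beta _ _ _ _ _ r0 c0 cS hv hw.
  by apply: (is_derive_eq h); rewrite G0 mulr0.
pose dir : config R N := (\matrix_(k < N) radial (ring_angle N k), 0).
pose c (t : R) : config R N := ring_config N r + t *: dir.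
(* Moving along the radial direction only changes the radius to [r + t], which stays positive near
   0. *)
have cE t : c t = ring_config N (r + t).
  congr (_, _); last by rewrite /= scaler0 addr0.
  apply/matrixP => k i; rewrite !mxE/=.
  by rewrite [RHS]mulrDl.
have c0 : c 0 = ring_config N r by rewrite cE addr0.
have cS : \forall t \near (0 : R), config_space (c t).
  near=> t; rewrite cE; apply: ring_in_config_space.
  rewrite -ltrBlDl sub0r; near: t; apply: lt_nbhsr.
  by rewrite oppr_lt0.
have dc : derivable c 0 1 by exact: derivable_line.
have hv k i : is_derive (0 : R) 1 (fun t => (c t).1 k i) (radial (ring_angle N k) 0 i).
  have h := is_derive_addf _ _ _ _ _
    (is_derive_cst (r * radial (ring_angle N k) 0 i) (0 : R) 1)
    (is_derive_mulf _ _ _ _ _ (is_derive_id (0 : R) 1)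
      (is_derive_cst (radial (ring_angle N k) 0 i) (0 : R) 1)).
  rewrite (_ : (fun t => (c t).1 k i) = (fun t => r * radial (ring_angle N k) 0 i +
     t * radial (ring_angle N k) 0 i)).
    by apply: (is_derive_eq h); rewrite add0r mul1r mulr0 addr0.
  by apply/funext => t; rewrite !mxE.
have hw k i : is_derive (0 : R) 1 (fun t => (c t).2 k i) ((0 : 'rV[R]_3) 0 i).
  rewrite mxE (_ : (fun t => (c t).2 k i) = cst ((ring_config N r).2 k i)).
    exact: is_derive_cst.
  by apply/funext => t; rewrite !mxE mulr0 addr0.
have [_ e1] := is_derive_ring_energy A B B0 alpha beta _ _ _ _ _ r0 c0 cS hv hw.
have [_ e2] := crit c c0 cS dc.
move: e1; rewrite e2 (eq_bigr (fun=> 1)) => [/esym/eqP|k _]; last exact: dot_radial.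
by rewrite sumr_const card_ord mulf_eq0 pnatr_eq0 (gtn_eqF N0) => /eqP.
Unshelve. all: by end_near. Qed.

(** * Limits for a large number of particles *)

Lemma cvg_natr_powRN {R : realType} (p : R) : 0 < p ->
  (n%:R `^ (- p) : R) @[n --> \oo] --> (0 : R).
Proof.
move=> p0; apply/cvgr0Pnorm_lt => e e0; near=> n.
have n0 : 0 < n%:R :> R.
  apply: le_lt_trans (powR_ge0 e^-1 p^-1) _; near: n; exact: nbhs_infty_gtr.
have hn : e^-1 `^ p^-1 < n%:R by near: n; exact: nbhs_infty_gtr.
rewrite ger0_norm ?powR_ge0// powRN invf_plt ?posrE ?powR_gt0//.
have := gt0_ltr_powR p0 _ _ hn; rewrite !nnegrE powR_ge0 (ltW n0) => /(_ isT isT).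
by rewrite -powRrM mulVf ?gt_eqF// powRr1// invr_ge0 ltW.
Unshelve. all: by end_near. Qed.

Lemma rate_le_powRN {R : realType} (beta : R) : 1 < beta ->
  exists2 p : R, 0 < p & forall N, (2 <= N)%N -> rate beta N <= N%:R `^ (- p).
Proof.
(* At [beta = 3] one power of [N] pays for the logarithm; for [beta > 3] the weaker exponent 1
   suffices. *)
move=> b1; exists (if 3 <= beta then 1 else beta - 1) => [|N N2].
  by case: ifP => _ //; rewrite subr_gt0.
have N0 : 0 < N%:R :> R by rewrite ltr0n; lia.
have N1 : 1 <= N%:R :> R by rewrite ler1n; lia.
rewrite /rate; case: ltgtP => [b3|b3|_].
- by rewrite powR_inv1 ?(ltW N0)// lef_pV2 ?posrE ?exprn_gt0// expr2 ler_peMr// ltW.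
- by rewrite opprB.
rewrite powR_inv1 ?(ltW N0)// mulrC ler_pdivrMr ?exprn_gt0// expr2 mulKf ?gt_eqF//.
exact/ltW/ln_sublinear.
Qed.

Lemma cvg_rate {R : realType} (beta : R) : 1 < beta ->
  (rate beta n : R) @[n --> \oo] --> (0 : R).
Proof.
move=> b1; have [p p0 hp] := rate_le_powRN _ b1.
apply: (@squeeze_cvgr _ _ _ R (cst 0) (fun n => n%:R `^ (- p))); last 2 first.
- exact: cvg_cst.
- exact: cvg_natr_powRN.
near=> n; have n2 : (2 <= n)%N by near: n; exists 2%N.
by rewrite rate_ge0//= hp.
Unshelve. all: by end_near. Qed.

Lemma cvg_rstar_chord {R : realType} (A B B0 alpha beta : R) :
  0 < A -> 0 < B -> 0 < B0 -> 1 < beta -> beta < alpha ->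
  (2 * rstar A B B0 alpha beta n * sin (pi / n%:R)) @[n --> \oo]
    --> hbar A B alpha beta.
Proof.
move=> A0 B_0 B00 b1 ab; have [C C0 hC] := @rstar_chord_rate R A B B0 _ _ A0 B_0 B00 b1 ab.
apply/cvgrPdist_le => e e0; near=> n.
have n2 : (2 <= n)%N by near: n; exists 2%N.
rewrite distrC (le_trans (hC n n2))// mulrC -ler_pdivlMr//.
have : `|rate beta n| <= e / C by near: n; apply: cvgr0_norm_le; [exact: cvg_rate|exact: divr_gt0].
by rewrite ger0_norm// rate_ge0.
Unshelve. all: by end_near. Qed.

(** With [x = pi/N], the quotient [x / sin x] is squeezed between 1 and [1 + x^2 / 2]. *)
Lemma cvg_arc_over_chord {R : realType} :
  (pi / n%:R / sin (pi / n%:R) : R) @[n --> \oo] --> (1 : R).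
Proof.
apply: (@squeeze_cvgr _ _ _ R (cst 1) (fun n => 1 + pi ^+ 2 / 2 * n%:R `^ (- 2))); last 2 first.
- exact: cvg_cst.
- rewrite -[X in _ --> X]addr0; apply: cvgD; first exact: cvg_cst.
  by rewrite -[X in _ --> X](mulr0 (pi ^+ 2 / 2)); apply: cvgM; [exact: cvg_cst|exact: cvg_natr_powRN].
near=> n; have n2 : (2 <= n)%N by near: n; exists 2%N.
have N0 : 0 < n%:R :> R by rewrite ltr0n; lia.
have s0 := @sin_piV_gt0 R n n2.
have x0 : 0 < pi / n%:R :> R by rewrite divr_gt0 ?pi_gt0.
have x2 : pi / n%:R <= pi / 2 :> R.
  by rewrite ler_wpM2l ?pi_ge0// lef_pV2 ?posrE// ler_nat.
have hs : pi / n%:R * ((1 + cos (pi / n%:R)) / 2) <= sin (pi / n%:R) :> R.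
  by apply: sin_ge_halfangle; rewrite (ltW x0)/=; have := @pi_ge0 R; lra.
have hc : 0 <= cos (pi / n%:R) :> R by apply: cos_ge0_pihalf; rewrite x2 andbT; lra.
have hc1 := one_sub_cos_le _ (ltW x0).
rewrite ler_pdivlMr// mul1r sin_le_id ?(ltW x0)//=.
have -> : pi ^+ 2 / 2 * n%:R `^ (- 2) = (pi / n%:R) ^+ 2 / 2 :> R.
  by rewrite powR_invn ?(ltW N0)// expr_div_n; ring.
rewrite ler_pdivrMr//; have := cos_le1 (pi / n%:R : R); move: hs hc hc1 s0 x0.
move: (pi / n%:R) => x; move: (sin x) (cos x) => s c hs hc hc1 s0 x0 c1.
(* The algebra behind the upper bound is [(1 + c) (2 - c) / 2 = 1 + c (1 - c) / 2]. *)
have h1 : x * ((1 + c) / 2) * (1 + (1 - c)) <= s * (1 + (1 - c)).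
  by apply: ler_wpM2r hs; lra.
have h2 : s * (1 - c) <= s * (x ^+ 2 / 2) by apply: ler_wpM2l hc1; exact: ltW.
have h3 : 0 <= x * (c * (1 - c)) by rewrite !mulr_ge0 ?subr_ge0// ltW.
have e : x = x * ((1 + c) / 2) * (1 + (1 - c)) - x * (c * (1 - c)) / 2 by field.
have e2 : (1 + x ^+ 2 / 2) * s = s * (1 + (1 - c)) + (s * (x ^+ 2 / 2) - s * (1 - c)) by ring.
rewrite e2 [leLHS]e; lra.
Unshelve. all: by end_near. Qed.

Lemma next_dist_ring {R : realType} (N : nat) (r : R) (k : 'I_N) : (2 <= N)%N ->
  0 < r -> next_dist (ring_config N r) k = 2 * r * sin (pi / N%:R).
Proof.
move=> N2 r0; rewrite /next_dist ring_pos_dist//; congr (_ * _).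
have N0 : N%:R != 0 :> R by rewrite pnatr_eq0; lia.
have s0 := @sin_piV_gt0 R N N2.
have kN := ltn_ord k; rewrite /=.
have [kl|kl] := ltnP k.+1 N.
  rewrite modn_small// -natr1.
  have -> : (k%:R - (k%:R + 1)) * pi / N%:R = - (pi / N%:R) :> R by field.
  by rewrite sinN normrN gtr0_norm.
(* The last particle is followed by particle 0; the half-angle [pi - pi/N] has the same sine. *)
have -> : k.+1 = N by lia.
rewrite modnn; have -> : (k%:R - 0%:R) * pi / N%:R = - (pi / N%:R) + pi :> R.
  have -> : k%:R = N%:R - 1 :> R by apply/eqP; rewrite eq_sym subr_eq natr1 eqr_nat; lia.
  by field.
by rewrite sinDpi sinN opprK gtr0_norm.
Qed.

(** * Conclusion *)

Lemma rstar_gt0 {R : realType} (A B B0 alpha beta : R) (N : nat) :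
  0 < A -> 0 < B -> 0 < B0 -> 1 < beta -> beta < alpha -> (2 <= N)%N ->
  0 < rstar A B B0 alpha beta N.
Proof.
move=> A0 B_0 B00 b1 ab N2; rewrite powR_gt0// divr_gt0//.
  by apply: Atilde_gt0 => //; lra.
by apply: Btilde_gt0 => //; lra.
Qed.

Lemma hbar_gt0 {R : realType} (A B alpha beta : R) :
  0 < A -> 0 < B -> 1 < beta -> beta < alpha -> 0 < hbar A B alpha beta.
Proof.
move=> A0 B_0 b1 ab.
have za : 0 < zeta alpha by apply: lt_le_trans (zeta_ge1 _ _); [|lra].
have zb : 0 < zeta beta by apply: lt_le_trans (zeta_ge1 _ _).
by rewrite powR_gt0// divr_gt0// mulr_gt0// mulr_gt0//; lra.
Qed.

(** The quotient of the two sequences is the side length over [hbar], times [x / sin x] at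
    [x = pi/N]; both factors tend to 1. *)
Lemma rstar_equiv {R : realType} (A B B0 alpha beta : R) :
  0 < A -> 0 < B -> 0 < B0 -> 1 < beta -> beta < alpha ->
  (fun N : nat => rstar A B B0 alpha beta N)
    ~_\oo (fun N : nat => N%:R / (2 * pi) * hbar A B alpha beta).
Proof.
move=> A0 B_0 B00 b1 ab; have h0 := @hbar_gt0 R A B _ _ A0 B_0 b1 ab.
apply/eqaddoP => e e0.
have lim1 : (2 * rstar A B B0 alpha beta n * sin (pi / n%:R) / hbar A B alpha beta
    * (pi / n%:R / sin (pi / n%:R))) @[n --> \oo] --> (1 : R).
  have e1 : hbar A B alpha beta / hbar A B alpha beta * 1 = 1 :> R.
    by rewrite divff ?gt_eqF// mulr1.
  rewrite -[X in _ --> X]e1.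
  apply: cvgM; last exact: cvg_arc_over_chord.
  by apply: cvgM; [exact: cvg_rstar_chord|exact: cvg_cst].
move/cvgrPdist_le : lim1 => /(_ _ e0) near1.
near=> n; have n2 : (2 <= n)%N by near: n; exists 2%N.
have N0 : 0 < n%:R :> R by rewrite ltr0n; lia.
have s0 := @sin_piV_gt0 R n n2; have p0 := @pi_gt0 R.
set g := n%:R / (2 * pi) * hbar A B alpha beta.
(* The difference is the quotient minus 1, times [g]: the form that the little-o condition asks
   for. *)
have gE : rstar A B B0 alpha beta n - g = (2 * rstar A B B0 alpha beta n *
    sin (pi / n%:R) / hbar A B alpha beta * (pi / n%:R / sin (pi / n%:R)) - 1) * g.
  rewrite /g; move: (sin _) s0 p0 => s s0.
  move: (@pi R) (hbar _ _ _ _) h0 (rstar _ _ _ _ _ _) => p h h0 r p0.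
  by field; rewrite !gt_eqF.
rewrite -[leLHS]/(`|rstar A B B0 alpha beta n - g|) gE normrM ler_wpM2r//.
by rewrite distrC; near: n.
Unshelve. all: by end_near. Qed.

Theorem theorem1p3 (R : realType) (A B B0 alpha beta : R)
    (hA : 0 < A) (hB : 0 < B) (hB0 : 0 < B0)
    (hbeta : 1 < beta) (halpha : beta < alpha) :
  (forall N : nat, (2 <= N)%N ->
     unique
       (fun r : R => 0 < r /\
          critical_point_on (@config_space R N) (@energy R A B B0 alpha beta N)
            (ring_config N r))
       (rstar A B B0 alpha beta N))
  /\
  (fun N : nat => rstar A B B0 alpha beta N)
    ~_\oo (fun N : nat => N%:R / (2 * pi) * hbar A B alpha beta)
  /\
  (forall k : forall n : nat, 'I_n.+2,
     next_dist (ring_config n.+2 (rstar A B B0 alpha beta n.+2)) (k n)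
       @[n --> \oo] --> hbar A B alpha beta)
  /\
  (exists C : R, 0 < C /\
     forall (N : nat) (k : 'I_N), (2 <= N)%N ->
       `| next_dist (ring_config N (rstar A B B0 alpha beta N)) k
          - hbar A B alpha beta | <= C * rate beta N).
Proof.
split=> [N N2|].
  have r0 := rstar_gt0 _ _ _ _ _ _ hA hB hB0 hbeta halpha N2.
  have N0 : (0 < N)%N by exact: ltnW.
  split=> [|r [r1 /(critical_ring _ _ _ _ _ _ _ N0 r1)/eqP]].
    by split=> //; apply/critical_ring => //; apply/eqP; rewrite ring_force_eq0.
  by rewrite ring_force_eq0// => /eqP.
split; first exact: rstar_equiv.
split=> [k|].
  (* The distance is the side length for every choice of [k]; the shift by 2 appears because [n]
     stands for [n + 2] particles. *)
  have := cvg_rstar_chord A B B0 alpha beta hA hB hB0 hbeta halpha.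
  rewrite -(cvg_shiftn 2); apply: cvg_trans; apply: near_eq_cvg; apply: nearW => n /=.
  by rewrite addn2 next_dist_ring// rstar_gt0.
have [C C0 hC] := rstar_chord_rate A B B0 alpha beta hA hB hB0 hbeta halpha.
exists C; split=> // N k N2; rewrite next_dist_ring//; first exact: hC.
exact: rstar_gt0.
Qed.
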